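(* Let $\mathbb{A}:D(\mathbb{A})\subset\mathbb{X}\to\mathbb{X}$ be the generator of a $C_0$-semigroup $\{e^{t\mathbb{A}}\}_{t\ge 0}$ of bounded linear operators on a Banach space $\mathbb{X}$, and let $\mathbb{V}\subset\mathbb{X}$ be a Banach space such that $(V_1)$–$(V_3)$ hold. Suppose $\mathbb{A}$ has property $(UHBD)$ with respect to $\mathbb{V}$, with constants $\mu_0\ge 0$, $M>0$, function $m$ and decompositions $\mathbb{X}=\mathbb{X}_\mu^-\oplus\mathbb{X}_\mu^+$, $\mu>\mu_0$. Let $\mathbb{F}:\mathbb{V}\to\mathbb{X}$ be Lipschitz with constant $L>0$, i.e. $\|\mathbb{F}(z_1)-\mathbb{F}(z_2)\|_{\mathbb{X}}\le L\|z_1-z_2\|_{\mathbb{V}}$ for all $z_1,z_2\in\mathbb{V}$. If there exists a nonstationary (i.e. nonconstant) $T$-periodic mild solution $z:\mathbb{R}\to\mathbb{V}$, $T>0$, of $\dot z=\mathbb{A}z+\mathbb{F}(z)$, then either $T\ge \frac{1}{\mu_0 M}$ or, for all $\mu\in\left(\mu_0,\frac{1}{MT}\right)$, $$1\le TL\cdot\left[\frac{K_\mu^+}{1-\mu MT}+\frac{K_\mu^-}{\mu T}\left(e^{-\mu T}m(T)+\int_0^{\mu T}m(s/\mu)\,e^{-s}\,ds\right)\right],$$ where $K_\mu^+:=\|\mathbb{P}_\mu^+\|_{\mathcal{L}(\mathbb{X},\mathbb{V})}$, $K_\mu^-:=\|\mathbb{P}_\mu^-\|_{\mathcal{L}(\mathbb{X},\mathbb{X})}$,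 and $\mathbb{P}_\mu^{\pm}:\mathbb{X}\to\mathbb{X}_\mu^{\pm}$ are the projections associated with the decomposition $\mathbb{X}=\mathbb{X}_\mu^-\oplus\mathbb{X}_\mu^+$.
   Context: Conditions on the Banach space $(\mathbb{V},\|\cdot\|_{\mathbb{V}})$: $(V_1)$ $D(\mathbb{A})\subset\mathbb{V}\subset\mathbb{X}$; $(V_2)$ $\mathbb{V}$ is embedded continuously into $\mathbb{X}$; $(V_3)$ $e^{t\mathbb{A}}(\mathbb{X})\subset\mathbb{V}$ for all $t>0$, and the family $\{e^{t\mathbb{A}}|_{\mathbb{V}}:\mathbb{V}\to\mathbb{V}\}_{t\ge0}$ is a $C_0$-semigroup of bounded linear operators on $\mathbb{V}$. Property $(UHBD)$ (uniformly half-bounded decomposition): there exist $\mu_0\ge0$, $M>0$ and a continuous $m:(0,+\infty)\to(0,+\infty)$ such that for any $\mu>\mu_0$ there is a decomposition $\mathbb{X}=\mathbb{X}_\mu^-\oplus\mathbb{X}_\mu^+$ into closed subspaces with: $(D_{\mu,+})$ $\mathbb{X}_\mu^+\subset D(\mathbb{A})$, $\mathbb{A}\mathbb{X}_\mu^+\subset\mathbb{X}_\mu^+$ and $\|\mathbb{A}w\|_{\mathbb{V}}\le\mu M\|w\|_{\mathbb{V}}$ for all $w\in\mathbb{X}_\mu^+$; $(D_{\mu,-})$ $\mathbb{A}(\mathbb{X}_\mu^-\cap D(\mathbb{A}))\subset\mathbb{X}_\mu^-$; $\|e^{t\mathbb{A}}w\|_{\mathbb{X}}\le e^{-\mu t}\|w\|_{\mathbb{X}}$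 and $\|e^{t\mathbb{A}}w\|_{\mathbb{V}}\le m(t)e^{-\mu t}\|w\|_{\mathbb{X}}$ for all $w\in\mathbb{X}_\mu^-$, $t>0$; and $\|e^{t\mathbb{A}}w\|_{\mathbb{V}}\le e^{-\mu t}\|w\|_{\mathbb{V}}$ for all $w\in\mathbb{X}_\mu^-\cap\mathbb{V}$, $t>0$; $(D_{\mu,0})$ $\int_0^t m(s)e^{-\mu s}\,ds<+\infty$ for all $t>0$. A continuous $z:(T_1,T_2)\to\mathbb{V}$ is a mild solution of $\dot z=\mathbb{A}z+\mathbb{F}(z)$ if for all $t_0<t$ in $(T_1,T_2)$, $z(t)=e^{(t-t_0)\mathbb{A}}z(t_0)+\int_{t_0}^t e^{(t-s)\mathbb{A}}\mathbb{F}(z(s))\,ds$. If $\mu_0=0$, the quantity $1/(\mu_0M)$ is read as $+\infty$. *)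

(* Defs.v *)
From Stdlib Require Import Reals.
From Coquelicot Require Import Coquelicot.
Set Implicit Arguments.
Unset Strict Implicit.
Open Scope R_scope.

Notation Banach := (CompleteNormedModule R_AbsRing).

(** Coquelicot's [is_linear] means "linear and bounded".  Only the values
    [U t] with [0 <= t] are relevant. *)
Record C0_semigroup (X : Banach) (U : R -> X -> X) : Prop := {
  C0_bounded : forall t, 0 <= t -> is_linear (U t);
  C0_zero : forall x, U 0 x = x;
  C0_add : forall s t, 0 <= s -> 0 <= t -> forall x, U (s + t) x = U s (U t x);
  C0_cont : forall x, filterlim (fun t => U t x) (at_right 0) (locally x)
}.

(** The unbounded operator is the pair [(D, A)]; the values of [A] outside
    its domain [D] are unconstrained. *)
Definition is_generator (X : Banach) (U : R -> X -> X)
    (D : X -> Prop) (A : X -> X) : Prop :=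
  forall x y : X,
    (D x /\ A x = y) <->
    filterlim (fun t => scal (/ t) (minus (U t x) x)) (at_right 0) (locally y).

(** The inclusion of [V] into [X] is the injective map [i]; [x] belongs to [V]
    as a subspace of [X] iff [x = i v] for some, necessarily unique, [v]. *)
Definition in_range (X V : Banach) (i : V -> X) (x : X) : Prop :=
  exists v : V, i v = x.

(** [x] lies in [V] and its norm in [V] is at most [r]. *)
Definition normV_le (X V : Banach) (i : V -> X) (x : X) (r : R) : Prop :=
  exists v : V, i v = x /\ norm v <= r.

Record admissible_space (X V : Banach) (U : R -> X -> X) (D : X -> Prop)
    (i : V -> X) : Prop := {
  V_inj : forall v w, i v = i w -> v = w;
  V_domain : forall x, D x -> in_range i x;
  V_embed : is_linear i;
  V_smoothing : forall t x, 0 < t -> in_range i (U t x);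
  V_semigroup : exists UV : R -> V -> V,
    C0_semigroup UV /\
    (forall t v, 0 <= t -> i (UV t v) = U t (i v))
}.

Record closed_subspace (X : Banach) (W : X -> Prop) : Prop := {
  sub_zero : W zero;
  sub_plus : forall x y, W x -> W y -> W (plus x y);
  sub_scal : forall (a : R) x, W x -> W (scal a x);
  sub_closed : closed W
}.

Definition direct_sum (X : Banach) (W1 W2 : X -> Prop) : Prop :=
  (forall x, exists x1 x2, W1 x1 /\ W2 x2 /\ x = plus x1 x2) /\
  (forall x, W1 x -> W2 x -> x = zero).

Record decomposition_at (X V : Banach) (U : R -> X -> X) (D : X -> Prop)
    (A : X -> X) (i : V -> X) (M : R) (m : R -> R) (mu : R)
    (Xm Xp : X -> Prop) : Prop := {
  dec_closed_m : closed_subspace Xm;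
  dec_closed_p : closed_subspace Xp;
  dec_sum : direct_sum Xm Xp;

  dec_p_domain : forall w, Xp w -> D w;
  dec_p_stable : forall w, Xp w -> Xp (A w);
  dec_p_bound : forall v, Xp (i v) -> normV_le i (A (i v)) (mu * M * norm v);

  dec_m_stable : forall w, Xm w -> D w -> Xm (A w);
  dec_m_XX : forall w t, Xm w -> 0 < t ->
    norm (U t w) <= exp (- (mu * t)) * norm w;
  dec_m_XV : forall w t, Xm w -> 0 < t ->
    normV_le i (U t w) (m t * exp (- (mu * t)) * norm w);
  dec_m_VV : forall v t, Xm (i v) -> 0 < t ->
    normV_le i (U t (i v)) (exp (- (mu * t)) * norm v);

  (* The integrand is positive and continuous on (0, t] but may be unbounded
     at 0: finiteness of the integral is convergence at 0. *)
  dec_integrable : forall t, 0 < t ->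
    ex_RInt_gen (fun s => m s * exp (- (mu * s))) (at_right 0) (at_point t)
}.

Record UHBD (X V : Banach) (U : R -> X -> X) (D : X -> Prop) (A : X -> X)
    (i : V -> X) (mu0 M : R) (m : R -> R) (Xm Xp : R -> X -> Prop) : Prop := {
  UHBD_mu0 : 0 <= mu0;
  UHBD_M : 0 < M;
  UHBD_m_pos : forall t, 0 < t -> 0 < m t;
  UHBD_m_cont : forall t, 0 < t -> continuous m t;
  UHBD_dec : forall mu, mu0 < mu ->
    decomposition_at U D A i M m mu (Xm mu) (Xp mu)
}.

(** When [X] is the direct sum of [W1] and [W2] this determines [P1], [P2]. *)
Definition projections (X : Banach) (W1 W2 : X -> Prop) (P1 P2 : X -> X)
  : Prop := forall x, W1 (P1 x) /\ W2 (P2 x) /\ x = plus (P1 x) (P2 x).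

(** The supremum is taken in [Rbar] and then coerced by [real], which sends
    infinite values to 0: it is the operator norm only for bounded [f]. *)
Definition op_norm (E G : Banach) (f : E -> G) : R :=
  real (Lub_Rbar (fun r => exists x : E, norm x <= 1 /\ r = norm (f x))).

(** The integral is the [X]-valued Riemann integral; the integrand is
    continuous in [X] whenever [U] is a C0-semigroup and [F] is continuous. *)
Definition mild_solution (X V : Banach) (U : R -> X -> X) (i : V -> X)
    (F : V -> X) (T1 T2 : Rbar) (z : R -> V) : Prop :=
  (forall t : R, Rbar_lt T1 t -> Rbar_lt t T2 -> continuous z t) /\
  (forall t0 t : R, Rbar_lt T1 t0 -> t0 < t -> Rbar_lt t T2 ->
    exists I : X,
      is_RInt (fun s => U (t - s) (F (z s))) t0 t I /\
      i (z t) = plus (U (t - t0) (i (z t0))) I).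

(** [1 / x] with the convention [1 / 0 = +oo]. *)
Definition inv_infty (x : R) : Rbar :=
  if Req_EM_T x 0 then p_infty else Finite (/ x).

(* Main.v *)
Require Import Defs.
From Stdlib Require Import Reals Lra Lia List Classical ClassicalEpsilon.
From Coquelicot Require Import Coquelicot.
Open Scope R_scope.

(** Fix [h] with [z(. + h) <> z] and put [y(t) = z(t + h) - z(t)], a
    [T]-periodic function of mean zero; let [Y > 0] be the integral of its
    [V]-norm over a period.  The closed graph theorem makes the projections
    bounded, and uniqueness for the evolution equation makes them commute with
    the semigroup, so that [y = y+ + y-] can be estimated componentwise in [L^1].

    On [X+] the generator is bounded by [mu M], so [y+] varies over a period by
    at most the integral of [mu M |y+| + K+ L |y|]; having mean zero, it
    satisfies [int |y+| <= T (mu M int |y+| + K+ L Y)].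

    On [X-] put [Phi(s) = int_0^T |e^{sA} y-(t)|_V dt].  By the variation of
    constants formula and periodicity, [Phi] decreases at rate at most
    [K- L Y p(s)], where [p(s)] bounds [e^{sA} : X- -> V]; here
    [p(s) = m(s) e^{-mu s}] for [s <= T] and [p(s) = m(T) e^{-mu s}] afterwards.
    Since [Phi(s) -> 0] as [s] grows, [Phi(0) = int |y-|] is at most
    [K- L Y int p].  Adding the two bounds and dividing by [Y] gives the claim.
    Working with [Phi] avoids integrating singular [V]-valued functions. *)

(** * Linear identities in modules *)

(** Subtracting a translate makes the problem homogeneous: the forcing
    [g(t) = F(z(t + h)) - F(z(t))] satisfies [|g| <= L |y|] whatever [F zero] is, so [Y] can be
    divided out at the end. The [L^1] norm over a period does not change under a shift of time, so
    the lag between the two sides of the variation of constants formula costs nothing.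

    A mild solution need not be differentiable, and the bound [m(s)] may blow up at 0. Differential
    inequalities are therefore stated through one-sided increments, and the singularity is reached
    only as the limit of estimates on [[s, T]].

    The decomposition is assumed invariant under the generator, not under the semigroup. Since [X+]
    lies in the domain, both components of a domain vector lie there, whence
    [|P+ A x|_V <= mu M |P+ x|_V]. A Gronwall argument on the domain, then density, bounds
    [P+ e^{tA} x] by [P+ x]; this makes [X-] invariant, and the invariance of [X+] then uses
    contractivity on [X-]. *)

Inductive mexp : Type :=
| MVar (n : nat)
| MZero
| MPlus (a b : mexp)
| MOpp (a : mexp)
| MScal (r : R) (a : mexp).

Section Reflection.
Context {V : ModuleSpace R_Ring}.

Fixpoint mdenote (l : list V) (e : mexp) : V :=
  match e with
  | MVar n => nth n l zero
  | MZero => zero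
  | MPlus a b => plus (mdenote l a) (mdenote l b)
  | MOpp a => opp (mdenote l a)
  | MScal r a => scal r (mdenote l a)
  end.

Fixpoint mcoef (e : mexp) (k : nat) : R :=
  match e with
  | MVar n => if Nat.eqb n k then 1 else 0
  | MZero => 0
  | MPlus a b => mcoef a k + mcoef b k
  | MOpp a => - mcoef a k
  | MScal r a => r * mcoef a k
  end.

Fixpoint comb (c : nat -> R) (l : list V) : V :=
  match l with
  | nil => zero
  | x :: l' => plus (scal (c O) x) (comb (fun n => c (S n)) l')
  end.

(** A recursion over the atoms rather than a quantifier over indices, so that computation unfolds it
    into a conjunction of real equations. *)
Fixpoint coef_eq (c d : nat -> R) (l : list V) : Prop :=
  match l with
  | nil => True
  | _ :: l' => c O = d O /\ coef_eq (fun n => c (S n)) (fun n => d (S n)) l'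
  end.

Lemma comb_eq (l : list V) : forall c d, coef_eq c d l -> comb c l = comb d l.
Proof.
induction l as [|x l IH]; intros c d H; simpl; trivial.
destruct H as [H0 H1]; rewrite H0; f_equal; auto.
Qed.

Lemma comb_zero (l : list V) : forall c, (forall n, c n = 0) -> comb c l = zero.
Proof.
induction l as [|x l IH]; intros c H; simpl; trivial.
rewrite H, IH; auto.
rewrite plus_zero_r; exact (scal_zero_l x).
Qed.

Lemma comb_plus (l : list V) : forall c d,
  comb (fun n => c n + d n) l = plus (comb c l) (comb d l).
Proof.
induction l as [|x l IH]; intros c d; simpl.
- symmetry; apply plus_zero_l.
- rewrite IH, (scal_distr_r (c O) (d O) x : scal (c O + d O) x = _).
  rewrite <- !plus_assoc; f_equal; rewrite !plus_assoc; f_equal; apply plus_comm.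
Qed.

Lemma comb_scal (l : list V) : forall r c,
  comb (fun n => r * c n) l = scal r (comb c l).
Proof.
induction l as [|x l IH]; intros r c; simpl.
- symmetry; apply scal_zero_r.
- rewrite IH, scal_distr_l; f_equal.
  symmetry; exact (scal_assoc r (c O) x).
Qed.

Lemma comb_var (l : list V) : forall n,
  comb (fun k => if Nat.eqb n k then 1 else 0) l = nth n l zero.
Proof.
induction l as [|x l IH]; intros [|n]; simpl; trivial.
- rewrite comb_zero by trivial.
  rewrite plus_zero_r; exact (scal_one x).
- rewrite IH, (scal_zero_l x : scal 0 x = zero); apply plus_zero_l.
Qed.

Lemma mdenote_comb (l : list V) (e : mexp) : mdenote l e = comb (mcoef e) l.
Proof.
induction e as [n| |a IHa b IHb|a IH|r a IH]; simpl.
- symmetry; apply comb_var.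
- symmetry; now apply comb_zero.
- rewrite IHa, IHb; symmetry; apply comb_plus.
- rewrite IH, <- (scal_opp_one (comb (mcoef a) l) : scal (-1) _ = _).
  rewrite <- (comb_scal l (-1)); apply comb_eq.
  generalize (mcoef a); clear IH; induction l as [|x l IHl]; intros c; simpl; [exact I|].
  split; [ring | apply IHl].
- rewrite IH; symmetry; apply comb_scal.
Qed.

(** Soundness of [module_eq]: both expressions normalise to combinations of the same atoms, which
    leaves one equation for [ring] or [field] per atom. *)
Lemma mdenote_eq (l : list V) (a b : mexp) :
  coef_eq (mcoef a) (mcoef b) l -> mdenote l a = mdenote l b.
Proof. intros H; rewrite !mdenote_comb; now apply comb_eq. Qed.

End Reflection.

Ltac mvars l e :=
  match e with
  | plus ?a ?b => let l1 := mvars l a in mvars l1 b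
  | minus ?a ?b => let l1 := mvars l a in mvars l1 b
  | opp ?a => mvars l a
  | scal _ ?a => mvars l a
  | zero => l
  | _ => minsert l l e
  end
with minsert l0 l e :=
  match l with
  | nil => constr:(e :: l0)
  | e :: _ => l0
  | _ :: ?l' => minsert l0 l' e
  end.

Ltac mindex l e :=
  match l with
  | e :: _ => constr:(O)
  | _ :: ?l' => let n := mindex l' e in constr:(S n)
  end.

Ltac mreify l e :=
  match e with
  | plus ?a ?b => let x := mreify l a in let y := mreify l b in constr:(MPlus x y)
  | minus ?a ?b =>
      let x := mreify l a in let y := mreify l b in constr:(MPlus x (MOpp y))
  | opp ?a => let x := mreify l a in constr:(MOpp x)
  | scal ?r ?a => let x := mreify l a in constr:(MScal r x)
  | zero => constr:(MZero)
  | _ => let n := mindex l e in constr:(MVar n)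
  end.

Ltac module_eq :=
  match goal with
  | |- @eq ?T ?a ?b =>
      let l := mvars (@nil T) a in
      let l := mvars l b in
      let x := mreify l a in
      let y := mreify l b in
      apply (mdenote_eq l x y); cbn [coef_eq mcoef Nat.eqb];
      repeat split; try ring; try (field; lra)
  end.

(** * Norms and limits *)

Section Norms.
Context {V : NormedModule R_AbsRing}.
Implicit Types x y z : V.

Lemma norm_minus_self x : norm (minus x x) = 0.
Proof. replace (minus x x) with (zero : V) by module_eq; apply norm_zero. Qed.

Lemma norm_minus_sym x y : norm (minus x y) = norm (minus y x).
Proof. rewrite <- (norm_opp (minus x y)); f_equal; module_eq. Qed.

Lemma norm_minus_triangle y x z :
  norm (minus x z) <= norm (minus x y) + norm (minus y z).
Proof.
replace (minus x z) with (plus (minus x y) (minus y z)) by module_eq.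
apply norm_triangle.
Qed.

Lemma norm_le_minus x y : norm x <= norm y + norm (minus x y).
Proof.
replace x with (plus y (minus x y)) at 1 by module_eq; apply norm_triangle.
Qed.

Lemma norm_minus_le x y : norm (minus x y) <= norm x + norm y.
Proof. unfold minus; rewrite <- (norm_opp y); apply norm_triangle. Qed.

(** The norm axiom gives only [<=]; the reverse inequality comes from scaling back by [/ r]. *)
Lemma norm_scal_pos (r : R) x : 0 <= r -> norm (scal r x) = r * norm x.
Proof.
intros Hr.
assert (Hle : forall s y, 0 <= s -> norm (scal s y) <= s * norm y).
{ intros s y Hs; generalize (norm_scal (s : R_AbsRing) y).
  change (abs (s : R_AbsRing)) with (Rabs s); rewrite Rabs_pos_eq; trivial. }
apply Rle_antisym; [now apply Hle|].
destruct Hr as [Hr|<-]; [|rewrite Rmult_0_l; apply norm_ge_0].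
assert (Hir := Rinv_0_lt_compat r Hr).
assert (H := Hle (/ r) (scal r x) ltac:(lra)).
replace (scal (/ r) (scal r x)) with x in H by module_eq.
apply (Rmult_le_compat_l r) in H; [|lra].
rewrite <- Rmult_assoc, Rinv_r, Rmult_1_l in H; lra.
Qed.

Lemma continuous_norm_iff (f : R -> V) (t : R) :
  continuous f t <->
  forall eps, 0 < eps -> exists d, 0 < d /\
    forall s, Rabs (s - t) < d -> norm (minus (f s) (f t)) < eps.
Proof.
eapply iff_trans; [exact (filterlim_locally_ball_norm f (f t))|]; split.
- intros H eps Heps; destruct (H (mkposreal _ Heps)) as [d Hd].
  exists d; split; [apply cond_pos | intros s Hs; apply (Hd s Hs)].
- intros H eps; destruct (H eps (cond_pos eps)) as [d [Hd1 Hd2]].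
  exists (mkposreal _ Hd1); intros s Hs; apply (Hd2 s Hs).
Qed.

Lemma at_right_norm_iff (f : R -> V) (l : V) :
  filterlim f (at_right 0) (locally l) <->
  forall eps, 0 < eps -> exists d, 0 < d /\
    forall s, 0 < s < d -> norm (minus (f s) l) < eps.
Proof.
eapply iff_trans; [exact (filterlim_locally_ball_norm f l)|]; split.
- intros H eps Heps; destruct (H (mkposreal _ Heps)) as [d Hd].
  exists d; split; [apply cond_pos | intros s Hs; apply (Hd s); [|lra]].
  change (Rabs (s - 0) < d); rewrite Rabs_pos_eq; lra.
- intros H eps; destruct (H eps (cond_pos eps)) as [d [Hd1 Hd2]].
  exists (mkposreal _ Hd1); intros s Hs Hs0; apply (Hd2 s); split; [exact Hs0|].
  change (Rabs (s - 0) < d) in Hs; rewrite Rabs_pos_eq in Hs; lra.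
Qed.

Lemma eventually_norm_iff (u : nat -> V) (l : V) :
  filterlim u eventually (locally l) <->
  forall eps, 0 < eps -> exists N, forall n, (N <= n)%nat -> norm (minus (u n) l) < eps.
Proof.
eapply iff_trans; [exact (filterlim_locally_ball_norm u l)|]; split.
- intros H eps Heps; exact (H (mkposreal _ Heps)).
- intros H eps; exact (H eps (cond_pos eps)).
Qed.

End Norms.

(* Stating completeness as a property of a [NormedModule] keeps all operations
   on one path of Coquelicot's hierarchy, so that terms match syntactically. *)
Definition seq_complete (V : NormedModule R_AbsRing) : Prop :=
  forall u : nat -> V,
  (forall eps, 0 < eps -> exists N, forall m n, (N <= n <= m)%nat ->
     norm (minus (u m) (u n)) < eps) ->
  exists l, filterlim u eventually (locally l).

Lemma complete_seq_complete (V : CompleteNormedModule R_AbsRing) :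
  seq_complete V.
Proof.
intros u H; apply (proj1 (filterlim_locally_cauchy (U := V) (F := eventually) u)); intros eps.
destruct (H eps (cond_pos eps)) as [N HN].
exists (fun n => (N <= n)%nat); split; [now exists N|].
intros m n Hm Hn.
apply (norm_compat1 (V := CompleteNormedModule.NormedModule _ V)).
destruct (Nat.le_ge_cases n m).
- rewrite norm_minus_sym; apply HN; lia.
- apply HN; lia.
Qed.

Lemma half_pow_small (C eps : R) : 0 <= C -> 0 < eps ->
  exists N, forall n, (N <= n)%nat -> C * (/ 2) ^ n < eps.
Proof.
intros HC Heps.
destruct (pow_lt_1_zero (/ 2)) with (y := eps / (C + 1)) as [N HN].
- rewrite Rabs_pos_eq; lra.
- apply Rdiv_lt_0_compat; lra.
- exists N; intros n Hn; specialize (HN n Hn).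
  assert (0 < (/ 2) ^ n) by (apply pow_lt; lra).
  rewrite Rabs_pos_eq in HN by lra.
  assert (eps = (C + 1) * (eps / (C + 1))) by (field; lra).
  nra.
Qed.

Section LinearMaps.
Context {X Y : NormedModule R_AbsRing} (f : X -> Y).
Hypothesis f_plus : forall x y, f (plus x y) = plus (f x) (f y).
Hypothesis f_scal : forall (k : R) x, f (scal k x) = scal k (f x).

Lemma additive_zero : f zero = zero.
Proof.
replace (zero : X) with (scal 0 (zero : X)) by module_eq.
rewrite f_scal; module_eq.
Qed.

Lemma additive_minus x y : f (minus x y) = minus (f x) (f y).
Proof.
replace (minus x y) with (plus x (scal (-1) y)) by module_eq.
rewrite f_plus, f_scal; module_eq.
Qed.

End LinearMaps.

Lemma linear_scal_R {X Y : NormedModule R_AbsRing} (f : X -> Y) (Hf : is_linear f)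
    (k : R) (x : X) : f (scal k x) = scal k (f x).
Proof. exact (linear_scal f Hf k x). Qed.

(** * Baire category and its consequences *)

(** If no [E n] were dense in a ball, one could choose nested balls with halving radii, the ball of
    index [n + 1] staying away from [E n]. Their centres converge to a point that belongs to no
    [E n]. *)
Lemma baire (X : NormedModule R_AbsRing) (E : nat -> X -> Prop) :
  seq_complete X ->
  (forall x, exists n, E n x) ->
  exists n x0 r, 0 < r /\
    forall y : X, norm (minus y x0) < r -> forall eps, 0 < eps ->
      exists e, E n e /\ norm (minus y e) < eps.
Proof.
intros HX Hcov; apply NNPP; intros Hno.
assert (Hstep : forall n (c : X * R), exists c' : X * R, 0 < snd c ->
  0 < snd c' <= snd c / 2 /\
  norm (minus (fst c') (fst c)) + snd c' <= snd c /\
  forall e, E n e -> snd c' < norm (minus (fst c') e)).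
{ intros n [x0 r]; cbn [fst snd].
  destruct (Rlt_dec 0 r) as [Hr|Hr]; [|exists (x0, r); intros; contradiction].
  apply NNPP; intros Hc; apply Hno; exists n, x0, r; split; trivial.
  intros y Hy eps Heps; apply NNPP; intros He; apply Hc.
  (* The three bounds serve, in order, strict separation from [E n], halving of the radius, and
     inclusion in the previous ball. *)
  set (s := Rmin (eps / 2) (Rmin (r / 2) (r - norm (minus y x0)))).
  assert (Hs1 : s <= eps / 2) by apply Rmin_l.
  assert (Hs2 : s <= r / 2) by (eapply Rle_trans; [apply Rmin_r|apply Rmin_l]).
  assert (Hs3 : s <= r - norm (minus y x0))
    by (eapply Rle_trans; [apply Rmin_r|apply Rmin_r]).
  assert (Hs0 : 0 < s) by (repeat apply Rmin_glb_lt; lra).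
  exists (y, s); cbn [fst snd]; intros _; split; [split; lra|]; split; [lra|].
  intros e Hne; apply Rnot_le_lt; intros Hle; apply He; exists e; split; trivial; lra. }
pose (step := fun n c => proj1_sig (constructive_indefinite_description _ (Hstep n c))).
assert (Hs : forall n c, 0 < snd c ->
  0 < snd (step n c) <= snd c / 2 /\
  norm (minus (fst (step n c)) (fst c)) + snd (step n c) <= snd c /\
  forall e, E n e -> snd (step n c) < norm (minus (fst (step n c)) e)).
{ intros n c; unfold step; apply proj2_sig. }
pose (c := fix c n := match n with O => (zero : X, 1) | S k => step k (c k) end).
assert (Hpos : forall n, 0 < snd (c n)).
{ induction n; simpl; [lra | apply (Hs n (c n) IHn)]. }
assert (Hsmall : forall n, snd (c n) <= (/ 2) ^ n).
{ induction n; simpl; [lra|]. destruct (Hs n (c n) (Hpos n)) as [[_ H] _]; lra. }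
assert (Hnest : forall n k,
  norm (minus (fst (c (k + n)%nat)) (fst (c n))) + snd (c (k + n)%nat) <= snd (c n)).
{ intros n; induction k as [|k IH]; simpl.
  - rewrite norm_minus_self; lra.
  - destruct (Hs (k + n)%nat (c (k + n)%nat) (Hpos _)) as [_ [H _]].
    generalize (norm_minus_triangle (fst (c (k + n)%nat))
                  (fst (step (k + n)%nat (c (k + n)%nat))) (fst (c n))); lra. }
destruct (HX (fun n => fst (c n))) as [x Hx].
{ intros eps Heps; destruct (half_pow_small 1 eps) as [N HN]; try lra.
  exists N; intros m n Hmn; specialize (HN n); specialize (Hsmall n).
  specialize (Hnest n (m - n)%nat); replace (m - n + n)%nat with m in Hnest by lia.
  generalize (Hpos m); specialize (HN ltac:(lia)); lra. }
rewrite eventually_norm_iff in Hx.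
destruct (Hcov x) as [n Hn].
(* The limit lies in every closed ball of the sequence, yet [x] in [E n] is farther from the next
   centre than its radius; [d] is this excess. *)
destruct (Hs n (c n) (Hpos n)) as [_ [_ H]]; specialize (H x Hn).
change (step n (c n)) with (c (S n)) in H.
set (d := norm (minus (fst (c (S n))) x) - snd (c (S n))) in *.
destruct (Hx d) as [N HN]; [unfold d; lra|].
specialize (HN (N + S n)%nat ltac:(lia)); specialize (Hnest (S n) N).
generalize (norm_minus_triangle (fst (c (N + S n)%nat)) (fst (c (S n))) x).
rewrite (norm_minus_sym (fst (c (S n))) (fst (c (N + S n)%nat))).
generalize (Hpos (N + S n)%nat); unfold d in HN; lra.
Qed.

Section ClosedGraph.
Context {X Y : NormedModule R_AbsRing} (f : X -> Y).
Hypotheses (HX : seq_complete X) (HY : seq_complete Y).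
Hypothesis f_plus : forall x y, f (plus x y) = plus (f x) (f y).
Hypothesis f_scal : forall (k : R) x, f (scal k x) = scal k (f x).

(** Some set [|f x| <= n] is dense in a ball, by Baire. Differences of its elements, rescaled,
    approximate any [x] up to half its norm with a controlled image; the limit process that removes
    the error is left to [closed_graph]. *)
Lemma approximate_preimage_bound : exists C, 0 < C /\
  forall x, exists x', norm (f x') <= C * norm x /\ norm (minus x x') <= norm x / 2.
Proof.
destruct (baire X (fun n x => norm (f x) <= INR n) HX) as [n [x0 [r [Hr H]]]].
{ intros x; destruct (nfloor_ex (norm (f x)) (norm_ge_0 _)) as [n Hn].
  exists (S n); rewrite S_INR; lra. }
assert (Hn := pos_INR n).
exists (4 * INR n / r + 1); split.
{ assert (0 <= 4 * INR n / r) by (apply Rdiv_le_0_compat; lra); lra. }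
intros x; destruct (Req_dec (norm x) 0) as [Hx|Hx].
{ exists (zero : X); rewrite additive_zero by trivial; rewrite norm_zero.
  replace (minus x (zero : X)) with x by module_eq; rewrite Hx; split; lra. }
assert (Hx0 : 0 < norm x) by (generalize (norm_ge_0 x); lra).
set (k := r / (2 * norm x)).
assert (Hk : 0 < k) by (apply Rdiv_lt_0_compat; lra).
assert (Hkx : k * norm x = r / 2) by (unfold k; field; lra).
assert (Heps : 0 < r / 8) by lra.
destruct (H (plus x0 (scal k x))) with (eps := r / 8) as [e1 [He1 Hd1]]; trivial.
{ replace (minus (plus x0 (scal k x)) x0) with (scal k x) by module_eq.
  rewrite norm_scal_pos; lra. }
destruct (H x0) with (eps := r / 8) as [e2 [He2 Hd2]]; trivial.
{ rewrite norm_minus_self; lra. }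
assert (Hik : 0 < / k) by now apply Rinv_0_lt_compat.
assert (Hikr : / k * r = 2 * norm x) by (unfold k; field; lra).
(* Here [e1] and [e2] approximate [x0 + k x] and [x0] within [r / 8]; since [r / k = 2 |x|], the
   total error [(r / 4) / k] is [|x| / 2]. *)
exists (scal (/ k) (minus e1 e2)); split.
- rewrite f_scal, additive_minus by trivial; rewrite norm_scal_pos by lra.
  assert (H1 := norm_minus_le (f e1) (f e2)).
  apply Rle_trans with (/ k * (2 * INR n)); [apply Rmult_le_compat_l; lra|].
  apply Rle_trans with (4 * INR n / r * norm x); [|nra].
  right; unfold k; field; lra.
- replace (minus x (scal (/ k) (minus e1 e2))) with
    (scal (/ k) (minus (minus (plus x0 (scal k x)) e1) (minus x0 e2)))
    by module_eq.
  rewrite norm_scal_pos by lra.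
  assert (H1 := norm_minus_le (minus (plus x0 (scal k x)) e1) (minus x0 e2)).
  apply Rle_trans with (/ k * (r / 4)); [apply Rmult_le_compat_l; lra|]; lra.
Qed.

Hypothesis f_closed : forall (u : nat -> X) x y,
  filterlim u eventually (locally x) ->
  filterlim (fun n => f (u n)) eventually (locally y) -> f x = y.

(** Iterating the approximation halves the remainder each time. The partial sums [u n] tend to [x],
    their images form a Cauchy sequence dominated by a geometric series of sum [2 C |x|], and
    closedness identifies the limit of the images with [f x]. *)
Lemma closed_graph : is_linear f.
Proof.
split; trivial.
destruct approximate_preimage_bound as [C [HC H]].
exists (2 * C); split; [lra|]; intros x.
pose (g := fun x => proj1_sig (constructive_indefinite_description _ (H x))).
assert (Hg : forall x, norm (f (g x)) <= C * norm x /\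
  norm (minus x (g x)) <= norm x / 2) by (intros x'; unfold g; apply proj2_sig).
clearbody g.
pose (rest := fix rest n := match n with O => x | S k => minus (rest k) (g (rest k)) end).
assert (Hrest : forall n, norm (rest n) <= norm x * (/ 2) ^ n).
{ induction n; simpl; [lra|]. generalize (proj2 (Hg (rest n))); lra. }
set (u := fun n => minus x (rest n)).
assert (Hu : forall n k, norm (minus (f (u (k + n)%nat)) (f (u n)))
  <= 2 * C * norm x * (/ 2) ^ n * (1 - (/ 2) ^ k)).
{ intros n; induction k as [|k IH].
  - simpl; rewrite norm_minus_self; lra.
  - assert (Hstep : minus (f (u (S k + n)%nat)) (f (u (k + n)%nat)) =
                    f (g (rest (k + n)%nat))).
    { rewrite <- additive_minus by trivial; f_equal; unfold u; simpl; module_eq. }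
    assert (H1 := norm_minus_triangle (f (u (k + n)%nat)) (f (u (S k + n)%nat)) (f (u n))).
    rewrite Hstep in H1.
    assert (H2 := proj1 (Hg (rest (k + n)%nat))).
    assert (H3 := Rmult_le_compat_l C _ _ ltac:(lra) (Hrest (k + n)%nat)).
    rewrite pow_add in H3; simpl ((/ 2) ^ S k).
    replace (2 * C * norm x * (/ 2) ^ n * (1 - / 2 * (/ 2) ^ k)) with
      (2 * C * norm x * (/ 2) ^ n * (1 - (/ 2) ^ k) +
       C * (norm x * ((/ 2) ^ k * (/ 2) ^ n))) by field.
    lra. }
assert (Hpow : forall k, 0 < (/ 2) ^ k) by (intros; apply pow_lt; lra).
assert (Hnx := norm_ge_0 x).
assert (HCx : 0 <= 2 * C * norm x) by (apply Rmult_le_pos; lra).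
assert (Hlim : filterlim u eventually (locally x)).
{ apply eventually_norm_iff; intros eps Heps.
  destruct (half_pow_small (norm x) eps) as [N HN]; trivial.
  exists N; intros n Hn; specialize (HN n Hn); specialize (Hrest n).
  replace (minus (u n) x) with (opp (rest n)) by (unfold u; module_eq).
  rewrite norm_opp; lra. }
destruct (HY (fun n => f (u n))) as [y Hy].
{ intros eps Heps; destruct (half_pow_small (2 * C * norm x) eps) as [N HN]; trivial.
  exists N; intros m n Hmn; specialize (HN n ltac:(lia)).
  specialize (Hu n (m - n)%nat); replace (m - n + n)%nat with m in Hu by lia.
  specialize (Hpow (m - n)%nat).
  assert (0 <= 2 * C * norm x * (/ 2) ^ n)
    by (apply Rmult_le_pos; [lra | apply pow_le; lra]).
  nra. }
rewrite (f_closed u x y Hlim Hy).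
apply le_epsilon; intros eps Heps.
destruct (proj1 (eventually_norm_iff _ _) Hy eps Heps) as [N HN]; specialize (HN N (Nat.le_refl _)).
rewrite norm_minus_sym in HN.
specialize (Hu O N); rewrite Nat.add_0_r in Hu.
assert (Hu0 : f (u O) = zero).
{ replace (u O) with (zero : X) by (unfold u; simpl; module_eq).
  now apply additive_zero. }
rewrite Hu0 in Hu.
replace (minus (f (u N)) (zero : Y)) with (f (u N)) in Hu by module_eq.
assert (H1 := norm_le_minus y (f (u N))).
assert (H2 := Rmult_le_pos _ _ HCx (Rlt_le _ _ (Hpow N))).
simpl ((/ 2) ^ 0) in Hu; lra.
Qed.

End ClosedGraph.

(** * Real functions with one-sided increment bounds *)

(** Continuous induction on the bound [phi r <= phi a + eps (r - a)]: the left condition lets the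
    bound reach the supremum of its range, the right condition carries it beyond. Neither a
    derivative nor two-sided continuity of [phi] enters. *)
Lemma nonincreasing_of_right_increments (phi : R -> R) (a b : R) :
  a <= b ->
  (forall s, a < s <= b -> forall eps, 0 < eps -> exists d, 0 < d /\
     forall k, 0 < k < d -> k <= s - a -> phi s <= phi (s - k) + eps) ->
  (forall s, a <= s < b -> forall eps, 0 < eps -> exists d, 0 < d /\
     forall k, 0 < k < d -> k <= b - s -> phi (s + k) <= phi s + k * eps) ->
  phi b <= phi a.
Proof.
intros Hab Hleft Hright.
assert (H : forall eps, 0 < eps -> phi b <= phi a + eps * (b - a)).
{ intros eps Heps.
  set (E := fun s => a <= s <= b /\
              forall r, a <= r <= s -> phi r <= phi a + eps * (r - a)).
  assert (Ha : E a).
  { split; [lra|]; intros r Hr; replace r with a by lra; lra. }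
  destruct (completeness E) as [c [Hub Hlub]].
  { exists b; intros s [Hs _]; lra. }
  { now exists a. }
  assert (Hac : a <= c) by now apply Hub.
  assert (Hcb : c <= b) by (apply Hlub; intros s [Hs _]; lra).
  assert (Hlt : forall r, a <= r < c -> phi r <= phi a + eps * (r - a)).
  { intros r Hr; apply NNPP; intros Hn.
    assert (c <= r); [|lra].
    apply Hlub; intros s [Hs1 Hs2]; apply Rnot_lt_le; intros Hrs.
    apply Hn, Hs2; lra. }
  assert (Hc : phi c <= phi a + eps * (c - a)).
  { destruct Hac as [Hac|<-]; [|lra].
    apply le_epsilon; intros eta Heta.
    destruct (Hleft c ltac:(lra) eta Heta) as [d [Hd H]].
    set (k := Rmin (d / 2) (c - a)).
    assert (Hk0 : 0 < k) by (apply Rmin_glb_lt; lra).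
    assert (Hk1 : k <= d / 2) by apply Rmin_l.
    assert (Hk2 : k <= c - a) by apply Rmin_r.
    specialize (H k ltac:(lra) ltac:(lra)).
    specialize (Hlt (c - k) ltac:(lra)); nra. }
  destruct Hcb as [Hcb | ->]; [exfalso|exact Hc].
  destruct (Hright c ltac:(lra) eps Heps) as [d [Hd H]].
  set (k := Rmin (d / 2) (b - c)).
  assert (Hk0 : 0 < k) by (apply Rmin_glb_lt; lra).
  assert (Hk1 : k <= d / 2) by apply Rmin_l.
  assert (Hk2 : k <= b - c) by apply Rmin_r.
  assert (HE : E (c + k)).
  { split; [lra|]; intros r Hr.
    destruct (Rlt_le_dec r c) as [Hrc|Hrc]; [apply Hlt; lra|].
    destruct Hrc as [Hrc|<-]; [|exact Hc].
    specialize (H (r - c) ltac:(lra) ltac:(lra)).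
    replace (c + (r - c)) with r in H by ring; nra. }
  specialize (Hub _ HE); lra. }
apply le_epsilon; intros eps Heps.
assert (Heps' : 0 < eps / (b - a + 1)) by (apply Rdiv_lt_0_compat; lra).
specialize (H _ Heps').
assert (eps / (b - a + 1) * (b - a + 1) = eps) by (field; lra).
nra.
Qed.

Lemma continuous_R_iff (f : R -> R) (t : R) :
  continuous f t <->
  forall eps, 0 < eps -> exists d, 0 < d /\
    forall s, Rabs (s - t) < d -> Rabs (f s - f t) < eps.
Proof. exact (continuous_norm_iff (V := R_NormedModule) f t). Qed.

Lemma ex_RInt_continuous_on (f : R -> R) (a b : R) :
  a <= b -> (forall s, a <= s <= b -> continuous f s) -> ex_RInt f a b.
Proof.
intros Hab H; apply (ex_RInt_continuous (V := R_CompleteNormedModule)).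
intros s Hs; rewrite Rmin_left, Rmax_right in Hs; auto.
Qed.

Lemma RInt_ge_const (f : R -> R) (a b l : R) :
  a <= b -> ex_RInt f a b -> (forall s, a <= s <= b -> l <= f s) ->
  (b - a) * l <= RInt f a b.
Proof.
intros Hab Hf H.
replace ((b - a) * l) with (RInt (fun _ : R => l) a b)
  by exact (RInt_const (V := R_CompleteNormedModule) a b l).
apply RInt_le; trivial.
- apply (ex_RInt_const (V := R_NormedModule)).
- intros s Hs; apply H; lra.
Qed.

Lemma RInt_le_const (f : R -> R) (a b l : R) :
  a <= b -> ex_RInt f a b -> (forall s, a <= s <= b -> f s <= l) ->
  RInt f a b <= (b - a) * l.
Proof.
intros Hab Hf H.
replace ((b - a) * l) with (RInt (fun _ : R => l) a b)
  by exact (RInt_const (V := R_CompleteNormedModule) a b l).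
apply RInt_le; trivial.
- apply (ex_RInt_const (V := R_NormedModule)).
- intros s Hs; apply H; lra.
Qed.

Lemma RInt_Chasles_on (f : R -> R) (a b c : R) :
  a <= b <= c -> (forall s, a <= s <= c -> continuous f s) ->
  RInt f a b + RInt f b c = RInt f a c.
Proof.
intros H Hf; apply (RInt_Chasles (V := R_CompleteNormedModule));
  apply ex_RInt_continuous_on; try lra; intros s Hs; apply Hf; lra.
Qed.

(** Subtracting the primitive of [rate] reduces the claim to the monotonicity criterion, applied to
    [phi(s) - RInt rate a s]. *)
Lemma increment_le_RInt (phi rate : R -> R) (a b : R) :
  a <= b ->
  (forall s, a <= s <= b -> continuous rate s) ->
  (forall s, a < s <= b -> forall eps, 0 < eps -> exists d, 0 < d /\
     forall k, 0 < k < d -> k <= s - a -> phi s <= phi (s - k) + eps) ->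
  (forall s, a <= s < b -> forall eps, 0 < eps -> exists d, 0 < d /\
     forall k, 0 < k < d -> k <= b - s ->
     phi (s + k) <= phi s + k * (rate s + eps)) ->
  phi b <= phi a + RInt rate a b.
Proof.
intros Hab Hc Hleft Hright.
assert (Hex : forall s t, a <= s <= t -> t <= b -> ex_RInt rate s t).
{ intros s t H1 H2; apply ex_RInt_continuous_on; [lra|].
  intros r Hr; apply Hc; lra. }
assert (H : phi b - RInt rate a b <= phi a - RInt rate a a).
{ apply (nonincreasing_of_right_increments (fun s => phi s - RInt rate a s)); trivial.
  - intros s Hs eps Heps.
    destruct (proj1 (continuous_R_iff _ _) (Hc s ltac:(lra)) 1 Rlt_0_1)
      as [d1 [Hd1 H1]].
    destruct (Hleft s Hs (eps / 2) ltac:(lra)) as [d2 [Hd2 H2]].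
    assert (Hr := Rabs_pos (rate s)).
    (* For [k < d3] the integral of [rate] over [[s - k, s]] exceeds [- eps / 2], as
       [rate >= - (|rate s| + 1)] there. *)
    set (d3 := eps / 2 / (Rabs (rate s) + 1)).
    assert (Hd3 : 0 < d3) by (apply Rdiv_lt_0_compat; lra).
    assert (Hd3' : d3 * (Rabs (rate s) + 1) = eps / 2) by (unfold d3; field; lra).
    exists (Rmin d1 (Rmin d2 d3)); split; [repeat apply Rmin_glb_lt; trivial|].
    intros k [Hk0 Hk] Hka.
    apply Rmin_Rgt_l in Hk; destruct Hk as [Hk1 Hk].
    apply Rmin_Rgt_l in Hk; destruct Hk as [Hk2 Hk3].
    specialize (H2 k ltac:(lra) Hka).
    rewrite <- (RInt_Chasles_on rate a (s - k) s)
      by (try lra; intros r Hr'; apply Hc; lra).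
    assert (Hlow : (s - (s - k)) * (- (Rabs (rate s) + 1)) <= RInt rate (s - k) s).
    { apply RInt_ge_const; [lra|apply Hex; lra|].
      intros r Hr'; specialize (H1 r); apply Rabs_def2 in H1;
        [|apply Rabs_def1; lra].
      generalize (Rle_abs (- rate s)); rewrite Rabs_Ropp; lra. }
    nra.
  - intros s Hs eps Heps.
    destruct (proj1 (continuous_R_iff _ _) (Hc s ltac:(lra)) (eps / 2) ltac:(lra))
      as [d1 [Hd1 H1]].
    destruct (Hright s Hs (eps / 2) ltac:(lra)) as [d2 [Hd2 H2]].
    exists (Rmin d1 d2); split; [apply Rmin_glb_lt; trivial|].
    intros k [Hk0 Hk] Hkb.
    apply Rmin_Rgt_l in Hk; destruct Hk as [Hk1 Hk2].
    specialize (H2 k ltac:(lra) Hkb).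
    rewrite <- (RInt_Chasles_on rate a s (s + k))
      by (try lra; intros r Hr'; apply Hc; lra).
    assert (Hlow : (s + k - s) * (rate s - eps / 2) <= RInt rate s (s + k)).
    { apply RInt_ge_const; [lra|apply Hex; lra|].
      intros r Hr'; specialize (H1 r); apply Rabs_def2 in H1;
        [|apply Rabs_def1; lra]; lra. }
    nra. }
rewrite (RInt_point (V := R_CompleteNormedModule) a rate : RInt rate a a = 0) in H.
lra.
Qed.

(** * Vector-valued integrals *)

Section Integrals.
Context {V : NormedModule R_AbsRing}.
Implicit Types f : R -> V.

Lemma is_RInt_functional f (a b : R) (I J : V) :
  is_RInt f a b I -> is_RInt f a b J -> I = J.
Proof.
intros HI HJ.
exact (filterlim_locally_unique (F := Riemann_fine a b) _ I J HI HJ).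
Qed.

Lemma is_RInt_shift f (a b c : R) (I : V) :
  is_RInt f (a + c) (b + c) I -> is_RInt (fun t => f (t + c)) a b I.
Proof.
intros H.
apply is_RInt_ext with (fun t => scal 1 (f (1 * t + c))).
- intros t _; rewrite Rmult_1_l; exact (scal_one _).
- apply is_RInt_comp_lin; rewrite !Rmult_1_l; exact H.
Qed.

Lemma is_RInt_periodic f (T c : R) (I : V) :
  (forall a b, exists J, is_RInt f a b J) ->
  (forall t, f (t + T) = f t) ->
  is_RInt f 0 T I -> is_RInt (fun t => f (t + c)) 0 T I.
Proof.
intros Hex Hper HI; apply is_RInt_shift; rewrite Rplus_0_l.
destruct (Hex 0 c) as [J HJ].
assert (HJ' : is_RInt f T (T + c) J).
{ apply is_RInt_ext with (fun t => f (t + - T)).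
  - intros t _; rewrite <- Hper; f_equal; ring.
  - apply is_RInt_shift.
    replace (T + - T) with 0 by ring; replace (T + c + - T) with c by ring.
    exact HJ. }
assert (H := is_RInt_Chasles _ _ _ _ _ _
  (is_RInt_Chasles _ _ _ _ _ _ (is_RInt_swap _ _ _ _ HJ) HI) HJ').
replace I with (plus (plus (opp J) I) J) by module_eq; exact H.
Qed.

Lemma is_RInt_near f (a : R) : continuous f a ->
  forall eps, 0 < eps -> exists d, 0 < d /\
    forall k J, 0 < k < d -> is_RInt f a (a + k) J ->
      norm (minus J (scal k (f a))) <= k * eps.
Proof.
intros Hf eps Heps.
destruct (proj1 (continuous_norm_iff f a) Hf eps Heps) as [d [Hd H]].
exists d; split; trivial; intros k J Hk HJ.
assert (HI : is_RInt (fun s => minus (f s) (f a)) a (a + k)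
               (minus J (scal (a + k - a) (f a)))).
{ apply (is_RInt_minus (V := V)); [exact HJ|apply (is_RInt_const (V := V))]. }
replace (scal k (f a)) with (scal (a + k - a) (f a)) by (f_equal; ring).
replace k with (a + k - a) at 2 by ring.
apply (norm_RInt_le_const (fun s => minus (f s) (f a)) a (a + k)); [lra| |exact HI].
intros s Hs; left; apply H; apply Rabs_def1; lra.
Qed.

End Integrals.

Lemma is_RInt_linear (X Y : NormedModule R_AbsRing) (l : X -> Y) (f : R -> X)
    (a b : R) (I : X) :
  is_linear l -> is_RInt f a b I -> is_RInt (fun t => l (f t)) a b (l I).
Proof.
intros Hl HI.
apply filterlim_ext with
  (fun ptd => l (scal (sign (b - a)) (Riemann_sum f ptd))).
{ intros ptd; rewrite (linear_scal l Hl); f_equal.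
  induction ptd as [x0|h s IH] using SF_cons_ind.
  - exact (linear_zero l Hl).
  - rewrite !Riemann_sum_cons, (linear_plus l Hl), (linear_scal l Hl), IH.
    reflexivity. }
eapply filterlim_comp; [exact HI|]; exact (linear_cont l I Hl).
Qed.

(** * Semigroups and their generators *)

Section Semigroup.
Context {X : NormedModule R_AbsRing} (U : R -> X -> X).
Hypotheses (HX : seq_complete X)
  (U_lin : forall t, 0 <= t -> is_linear (U t))
  (U_0 : forall x, U 0 x = x)
  (U_add : forall s t, 0 <= s -> 0 <= t -> forall x, U (s + t) x = U s (U t x))
  (U_cont : forall x, filterlim (fun t => U t x) (at_right 0) (locally x)).

(** Uniform boundedness near 0 by Baire, applied to the vectors whose orbit stays below [n + 1]
    during time [/ (n + 1)]; right continuity at 0 makes these sets cover [X]. Boundedness of each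
    single [U t] extends the bound from a dense subset of a ball to the whole ball. *)
Lemma semigroup_locally_bounded : exists d C, 0 < d /\ 0 < C /\
  forall t x, 0 <= t <= d -> norm (U t x) <= C * norm x.
Proof.
destruct (baire X (fun n x => forall t, 0 < t <= / INR (S n) ->
            norm (U t x) <= INR (S n)) HX) as [n [x0 [r [Hr H]]]].
{ intros x; destruct (proj1 (at_right_norm_iff _ _) (U_cont x) 1 Rlt_0_1)
    as [d [Hd H]].
  destruct (nfloor_ex (norm x + 1 + / d)) as [n [_ Hn]].
  { assert (Hx := norm_ge_0 x); assert (Hid := Rinv_0_lt_compat d Hd); lra. }
  rewrite <- S_INR in Hn.
  assert (Hx := norm_ge_0 x); assert (Hid := Rinv_0_lt_compat d Hd).
  exists n; intros t Ht.
  assert (Htd : / INR (S n) < d).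
  { rewrite <- (Rinv_inv d); apply Rinv_lt_contravar; [|lra].
    apply Rmult_lt_0_compat; lra. }
  specialize (H t ltac:(lra)); generalize (norm_le_minus (U t x) x); lra. }
set (N := INR (S n)) in *.
assert (HN : 0 < N) by (apply lt_0_INR; lia).
assert (Hball : forall t y, 0 < t <= / N -> norm (minus y x0) < r -> norm (U t y) <= N).
{ intros t y Ht Hy; destruct (U_lin t ltac:(lra)) as [_ _ [C [HC HUt]]].
  apply le_epsilon; intros eps Heps.
  destruct (H y Hy (eps / C)) as [e [He1 He2]]; [now apply Rdiv_lt_0_compat|].
  specialize (He1 t Ht); specialize (HUt (minus y e)).
  rewrite linear_minus in HUt by (apply U_lin; lra).
  assert (C * (eps / C) = eps) by (field; lra).
  generalize (norm_le_minus (U t y) (U t e)); nra. }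
(* Writing [x] as [((x0 + k x) - x0) / k] gives [2 N / k = 4 N |x| / r]; the added 1 covers [t = 0],
   where [U 0] is the identity. *)
exists (/ N), (4 * N / r + 1); split; [now apply Rinv_0_lt_compat|].
assert (HC0 : 0 < 4 * N / r) by (apply Rdiv_lt_0_compat; lra).
split; [lra|]; intros t x Ht.
assert (Hx := norm_ge_0 x).
destruct (proj1 Ht) as [Ht0|<-]; [|rewrite U_0; nra].
destruct Hx as [Hx|Hx].
- set (k := r / (2 * norm x)).
  assert (Hk : 0 < k) by (apply Rdiv_lt_0_compat; lra).
  assert (H1 := Hball t (plus x0 (scal k x)) ltac:(lra)).
  assert (H2 := Hball t x0 ltac:(lra)).
  rewrite norm_minus_self in H2.
  replace (minus (plus x0 (scal k x)) x0) with (scal k x) in H1 by module_eq.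
  rewrite norm_scal_pos in H1 by lra.
  assert (Hkx : k * norm x = r / 2) by (unfold k; field; lra).
  specialize (H1 ltac:(lra)); specialize (H2 Hr).
  assert (HUt := U_lin t ltac:(lra)).
  replace (U t x) with (scal (/ k) (minus (U t (plus x0 (scal k x))) (U t x0))).
  2: { rewrite (linear_plus _ HUt), (linear_scal _ HUt); module_eq. }
  assert (Hik := Rinv_0_lt_compat k Hk).
  rewrite norm_scal_pos by lra.
  assert (H3 := norm_minus_le (U t (plus x0 (scal k x))) (U t x0)).
  apply Rle_trans with (/ k * (2 * N)); [apply Rmult_le_compat_l; lra|].
  apply Rle_trans with (4 * N / r * norm x); [|nra].
  right; unfold k; field; lra.
- destruct (U_lin t ltac:(lra)) as [_ _ [C [_ HUt]]].
  specialize (HUt x); rewrite <- Hx in *; lra.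
Qed.

Lemma semigroup_right_cont t x : 0 <= t ->
  forall eps, 0 < eps -> exists d, 0 < d /\
    forall k, 0 < k < d -> norm (minus (U (t + k) x) (U t x)) < eps.
Proof.
intros Ht eps Heps.
destruct (proj1 (at_right_norm_iff _ _) (U_cont (U t x)) eps Heps) as [d [Hd H]].
exists d; split; trivial; intros k Hk.
rewrite Rplus_comm, U_add by lra; now apply H.
Qed.

(** With [w = U (t - d) x] for a fixed small [d], the difference is [U (d - k)] applied to
    [U k w - w]; the local bound on [U] reduces it to right continuity at 0. *)
Lemma semigroup_left_cont t x : 0 < t ->
  forall eps, 0 < eps -> exists d, 0 < d /\
    forall k, 0 < k < d -> k <= t -> norm (minus (U t x) (U (t - k) x)) < eps.
Proof.
intros Ht eps Heps.
destruct semigroup_locally_bounded as [d0 [C [Hd0 [HC HU]]]].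
set (d := Rmin d0 t).
assert (Hd1 : d <= d0) by apply Rmin_l.
assert (Hd2 : d <= t) by apply Rmin_r.
assert (Hd : 0 < d) by now apply Rmin_glb_lt.
destruct (proj1 (at_right_norm_iff _ _) (U_cont (U (t - d) x)) (eps / C))
  as [d' [Hd' H]].
{ now apply Rdiv_lt_0_compat. }
exists (Rmin d d'); split; [now apply Rmin_glb_lt|].
intros k [Hk0 Hk] _.
apply Rmin_Rgt_l in Hk; destruct Hk as [Hk1 Hk2].
replace (U t x) with (U (d - k) (U k (U (t - d) x))).
2: { rewrite <- !U_add by lra; f_equal; ring. }
replace (U (t - k) x) with (U (d - k) (U (t - d) x)).
2: { rewrite <- U_add by lra; f_equal; ring. }
rewrite <- linear_minus by (apply U_lin; lra).
assert (H1 := HU (d - k) (minus (U k (U (t - d) x)) (U (t - d) x)) ltac:(lra)).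
specialize (H k ltac:(lra)).
assert (C * (eps / C) = eps) by (field; lra).
nra.
Qed.

(** Nothing is known of [U] at negative times, so the orbit is extended evenly. This makes it
    continuous on the whole line and hence integrable between any bounds. *)
Lemma semigroup_abs_cont x : forall t, continuous (fun s => U (Rabs s) x) t.
Proof.
assert (Hpos : forall t, 0 <= t -> forall eps, 0 < eps -> exists d, 0 < d /\
  forall s, 0 <= s -> Rabs (s - t) < d -> norm (minus (U s x) (U t x)) < eps).
{ intros t Ht eps Heps.
  destruct (semigroup_right_cont t x Ht eps Heps) as [d1 [Hd1 H1]].
  assert (Hl : exists d, 0 < d /\ forall k, 0 < k < d -> k <= t ->
            norm (minus (U t x) (U (t - k) x)) < eps).
  { destruct Ht as [Ht|<-]; [now apply semigroup_left_cont|].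
    exists 1; split; [lra|]; intros; lra. }
  destruct Hl as [d2 [Hd2 H2]].
  exists (Rmin d1 d2); split; [now apply Rmin_glb_lt|].
  intros s Hs Hst.
  assert (Hm1 := Rmin_l d1 d2); assert (Hm2 := Rmin_r d1 d2).
  apply Rabs_def2 in Hst.
  destruct (Rtotal_order s t) as [Hlt|[->|Hgt]].
  - rewrite norm_minus_sym; replace s with (t - (t - s)) by ring; apply H2; lra.
  - rewrite norm_minus_self; lra.
  - replace s with (t + (s - t)) by ring; apply H1; lra. }
intros t; apply continuous_norm_iff; intros eps Heps.
destruct (Hpos (Rabs t) (Rabs_pos t) eps Heps) as [d [Hd H]].
exists d; split; trivial; intros s Hs; apply H; [apply Rabs_pos|].
eapply Rle_lt_trans; [apply Rabs_triang_inv2|exact Hs].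
Qed.

(** The relation [A x = y], with the difference quotient multiplied out so that bounded operators
    can be applied to the estimate directly. *)
Definition right_deriv (x y : X) : Prop :=
  forall eps, 0 < eps -> exists d, 0 < d /\
    forall k, 0 < k < d -> norm (minus (minus (U k x) x) (scal k y)) <= k * eps.

Lemma right_deriv_iff x y :
  filterlim (fun t => scal (/ t) (minus (U t x) x)) (at_right 0) (locally y)
  <-> right_deriv x y.
Proof.
eapply iff_trans; [apply at_right_norm_iff|].
assert (Hn : forall k, 0 < k -> norm (minus (minus (U k x) x) (scal k y)) =
  k * norm (minus (scal (/ k) (minus (U k x) x)) y)).
{ intros k Hk; rewrite <- norm_scal_pos by lra; f_equal.
  generalize (U k x); intros w; module_eq. }
split; intros H eps Heps.
- destruct (H eps Heps) as [d [Hd H']]; exists d; split; trivial; intros k Hk.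
  rewrite Hn by lra; apply Rmult_le_compat_l; [lra|]; left; now apply H'.
- destruct (H (eps / 2)) as [d [Hd H']]; [lra|]; exists d; split; trivial; intros k Hk.
  specialize (H' k Hk); rewrite Hn in H' by lra.
  apply Rmult_le_reg_l in H'; [|lra].
  eapply Rle_lt_trans; [exact H'|lra].
Qed.

Lemma right_deriv_minus x1 x2 y1 y2 :
  right_deriv x1 y1 -> right_deriv x2 y2 ->
  right_deriv (minus x1 x2) (minus y1 y2).
Proof.
intros H1 H2 eps Heps.
destruct (H1 (eps / 2) ltac:(lra)) as [d1 [Hd1 H1']].
destruct (H2 (eps / 2) ltac:(lra)) as [d2 [Hd2 H2']].
exists (Rmin d1 d2); split; [now apply Rmin_glb_lt|].
intros k [Hk0 Hk]; apply Rmin_Rgt_l in Hk; destruct Hk as [Hk1 Hk2].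
specialize (H1' k ltac:(lra)); specialize (H2' k ltac:(lra)).
rewrite (linear_minus (U k)) by (apply U_lin; lra).
replace (minus (minus (minus (U k x1) (U k x2)) (minus x1 x2)) (scal k (minus y1 y2)))
  with (minus (minus (minus (U k x1) x1) (scal k y1))
              (minus (minus (U k x2) x2) (scal k y2))) by module_eq.
eapply Rle_trans; [apply norm_minus_le|]; lra.
Qed.

Lemma right_deriv_semigroup t x y :
  0 <= t -> right_deriv x y -> right_deriv (U t x) (U t y).
Proof.
intros Ht H eps Heps; assert (Hl := U_lin t Ht).
destruct (linear_norm _ Hl) as [C [HC HU]].
destruct (H (eps / C)) as [d [Hd H']]; [now apply Rdiv_lt_0_compat|].
exists d; split; trivial; intros k Hk; specialize (H' k Hk).
replace (U k (U t x)) with (U t (U k x)).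
2: { rewrite <- !U_add by lra; f_equal; ring. }
rewrite <- (linear_scal _ Hl), <- !(linear_minus (U t)) by trivial.
eapply Rle_trans; [apply HU|].
replace (k * eps) with (C * (k * (eps / C))) by (field; lra).
apply Rmult_le_compat_l; [lra|exact H'].
Qed.

Hypothesis X_int : forall f : R -> X, (forall t, continuous f t) ->
  forall a b, exists I, is_RInt f a b I.

(** The classical identity for the generator on orbit integrals: applying [U k] shifts the interval
    by [k], so the change is the integral over [[h, h + k]] minus the integral over [[0, k]]. *)
Lemma right_deriv_integral h x I : 0 < h ->
  is_RInt (fun s => U (Rabs s) x) 0 h I -> right_deriv I (minus (U h x) x).
Proof.
intros Hh HI eps Heps.
set (u := fun s => U (Rabs s) x) in *.
assert (Hu : forall t, continuous u t) by apply semigroup_abs_cont.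
destruct (is_RInt_near u h (Hu h) (eps / 2) ltac:(lra)) as [d1 [Hd1 H1]].
destruct (is_RInt_near u 0 (Hu 0) (eps / 2) ltac:(lra)) as [d2 [Hd2 H2]].
exists (Rmin d1 d2); split; [now apply Rmin_glb_lt|].
intros k [Hk0 Hk]; apply Rmin_Rgt_l in Hk; destruct Hk as [Hk1 Hk2].
destruct (X_int u Hu h (h + k)) as [I1 HI1].
destruct (X_int u Hu 0 (0 + k)) as [I2 HI2].
specialize (H1 k I1 ltac:(lra) HI1); specialize (H2 k I2 ltac:(lra) HI2).
rewrite Rplus_0_l in HI2.
assert (HUI : is_RInt u k (h + k) (U k I)).
{ apply is_RInt_ext with (fun s => (fun r => U k (u r)) (s + - k)).
  - rewrite Rmin_left, Rmax_right by lra; intros s Hs; unfold u.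
    rewrite !Rabs_pos_eq by lra; rewrite <- U_add by lra; f_equal; ring.
  - apply (is_RInt_shift (fun r => U k (u r))).
    replace (k + - k) with 0 by ring; replace (h + k + - k) with h by ring.
    apply (is_RInt_linear X X (U k) u); [apply U_lin; lra|exact HI]. }
assert (Heq : plus I I1 = plus I2 (U k I)).
{ apply (is_RInt_functional u 0 (h + k)).
  - exact (is_RInt_Chasles _ _ _ _ _ _ HI HI1).
  - exact (is_RInt_Chasles _ _ _ _ _ _ HI2 HUI). }
assert (Hh' : u h = U h x) by (unfold u; rewrite Rabs_pos_eq by lra; reflexivity).
assert (H0 : u 0 = x) by (unfold u; rewrite Rabs_R0; apply U_0).
rewrite Hh' in H1; rewrite H0 in H2.
replace (U k I) with (minus (plus I I1) I2) by (rewrite Heq; module_eq).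
replace (minus (minus (minus (plus I I1) I2) I) (scal k (minus (U h x) x)))
  with (minus (minus I1 (scal k (U h x))) (minus I2 (scal k x))) by module_eq.
eapply Rle_trans; [apply norm_minus_le|]; lra.
Qed.

(** The means of the orbit over [[0, h]] lie in the domain and tend to [x] as [h] tends to 0. *)
Lemma domain_dense x eps : 0 < eps ->
  exists x' y', right_deriv x' y' /\ norm (minus x' x) < eps.
Proof.
intros Heps.
assert (Hu := semigroup_abs_cont x).
destruct (is_RInt_near _ 0 (Hu 0) (eps / 2) ltac:(lra)) as [d [Hd H]].
set (h := d / 2).
destruct (X_int _ Hu 0 (0 + h)) as [I HI].
specialize (H h I ltac:(unfold h; lra) HI).
rewrite Rplus_0_l in HI; rewrite Rabs_R0, U_0 in H.
assert (Hh : 0 < h) by (unfold h; lra).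
assert (Hih := Rinv_0_lt_compat h Hh).
assert (HD := right_deriv_integral h x I Hh HI).
exists (scal (/ h) I), (scal (/ h) (minus (U h x) x)); split.
- intros e He; destruct (HD (e * h)) as [d' [Hd' H']]; [nra|].
  exists d'; split; trivial; intros k Hk; specialize (H' k Hk).
  rewrite (linear_scal (U k)) by (apply U_lin; lra).
  apply Rle_trans with
    (norm (scal (/ h) (minus (minus (U k I) I) (scal k (minus (U h x) x))))).
  { right; f_equal; module_eq. }
  rewrite norm_scal_pos by lra.
  replace (k * e) with (/ h * (k * (e * h))) by (field; lra).
  apply Rmult_le_compat_l; [lra|exact H'].
- eapply Rle_lt_trans with (norm (scal (/ h) (minus I (scal h x)))).
  { right; f_equal; module_eq. }
  rewrite norm_scal_pos by lra.
  apply Rle_lt_trans with (/ h * (h * (eps / 2))).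
  + apply Rmult_le_compat_l; [lra|exact H].
  + replace (/ h * (h * (eps / 2))) with (eps / 2) by (field; lra); lra.
Qed.

End Semigroup.

(** * Density and Gronwall estimates *)

Lemma lim_minus (V : NormedModule R_AbsRing) (u w : nat -> V) (x y : V) :
  filterlim u eventually (locally x) -> filterlim w eventually (locally y) ->
  filterlim (fun n => minus (u n) (w n)) eventually (locally (minus x y)).
Proof.
intros Hu Hw; apply eventually_norm_iff; intros eps Heps.
destruct (proj1 (eventually_norm_iff _ _) Hu (eps / 2) ltac:(lra)) as [N1 H1].
destruct (proj1 (eventually_norm_iff _ _) Hw (eps / 2) ltac:(lra)) as [N2 H2].
exists (N1 + N2)%nat; intros n Hn.
specialize (H1 n ltac:(lia)); specialize (H2 n ltac:(lia)).
replace (minus (minus (u n) (w n)) (minus x y))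
  with (minus (minus (u n) x) (minus (w n) y)) by module_eq.
eapply Rle_lt_trans; [apply norm_minus_le|]; lra.
Qed.

Lemma dense_norm_le (X Y Z : NormedModule R_AbsRing) (E : X -> Prop)
    (f : X -> Y) (g : X -> Z) (a : R) :
  is_linear f -> is_linear g -> 0 <= a ->
  (forall x eps, 0 < eps -> exists x', E x' /\ norm (minus x' x) < eps) ->
  (forall x, E x -> norm (f x) <= a * norm (g x)) ->
  forall x, norm (f x) <= a * norm (g x).
Proof.
intros Hf Hg Ha HE H x; apply le_epsilon; intros eps Heps.
destruct (linear_norm _ Hf) as [C [HC HCf]].
destruct (linear_norm _ Hg) as [C' [HC' HCg]].
assert (Hden : 0 < C + a * C') by nra.
destruct (HE x (eps / (C + a * C'))) as [x' [Hx' Hd]].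
{ now apply Rdiv_lt_0_compat. }
specialize (H x' Hx'); specialize (HCf (minus x' x)); specialize (HCg (minus x' x)).
rewrite (linear_minus f) in HCf by trivial; rewrite (linear_minus g) in HCg by trivial.
rewrite norm_minus_sym in HCf.
assert (H1 := norm_le_minus (f x) (f x')).
assert (H2 := norm_le_minus (g x') (g x)).
assert (H3 : a * norm (g x') <= a * (norm (g x) + C' * norm (minus x' x)))
  by (apply Rmult_le_compat_l; lra).
assert (H4 : (C + a * C') * norm (minus x' x) <= eps).
{ replace eps with ((C + a * C') * (eps / (C + a * C'))) by (field; lra).
  apply Rmult_le_compat_l; lra. }
lra.
Qed.

Lemma exp_monotone (x y : R) : x <= y -> exp x <= exp y.
Proof. intros [H|<-]; [left; now apply exp_increasing|apply Rle_refl]. Qed.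

(** Gronwall's inequality from increments. The monotonicity criterion is applied to
    [exp (- c s) |q s|], and then, using this first bound, to
    [|q s - q 0| - (exp (c s) - 1) |q 0|]. *)
Lemma exp_growth (V : NormedModule R_AbsRing) (q : R -> V) (c : R) :
  0 <= c ->
  (forall s, 0 < s -> forall eps, 0 < eps -> exists d, 0 < d /\
     forall k, 0 < k < d -> k <= s -> norm (minus (q s) (q (s - k))) <= eps) ->
  (forall s, 0 <= s -> forall eps, 0 < eps -> exists d, 0 < d /\
     forall k, 0 < k < d ->
     norm (minus (q (s + k)) (q s)) <= k * (c * norm (q s) + eps)) ->
  forall t, 0 <= t ->
  norm (q t) <= exp (c * t) * norm (q 0) /\
  norm (minus (q t) (q 0)) <= (exp (c * t) - 1) * norm (q 0).
Proof.
intros Hc Hleft Hright.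
assert (Hexp : forall s k, exp (c * (s + k)) = exp (c * s) * exp (c * k)).
{ intros s k; rewrite <- exp_plus; f_equal; ring. }
assert (H : forall t, 0 <= t -> norm (q t) <= exp (c * t) * norm (q 0)).
{ intros t Ht.
  assert (H : exp (- (c * t)) * norm (q t) <= exp (- (c * 0)) * norm (q 0)).
  { apply (nonincreasing_of_right_increments
             (fun s => exp (- (c * s)) * norm (q s))); trivial.
    - intros s Hs eps Heps.
      destruct (Hleft s ltac:(lra) eps Heps) as [d [Hd H]].
      exists d; split; trivial; intros k Hk Hks; specialize (H k Hk ltac:(lra)).
      assert (H1 := norm_le_minus (q s) (q (s - k))).
      assert (H2 : exp (- (c * s)) <= exp (- (c * (s - k))))
        by (apply exp_monotone; nra).
      assert (H3 : exp (- (c * s)) <= 1)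
        by (rewrite <- exp_0; apply exp_monotone; nra).
      assert (H4 := exp_pos (- (c * s))).
      assert (H5 := norm_ge_0 (q (s - k))).
      apply Rle_trans with (exp (- (c * s)) * (norm (q (s - k)) + eps)); nra.
    - intros s Hs eps Heps.
      destruct (Hright s ltac:(lra) eps Heps) as [d [Hd H]].
      exists d; split; trivial; intros k Hk Hks; specialize (H k Hk).
      assert (H1 := norm_le_minus (q (s + k)) (q s)).
      assert (H2 := exp_ineq1_le (c * k)).
      assert (H3 := exp_pos (- (c * s))).
      assert (H4 := norm_ge_0 (q s)).
      replace (exp (- (c * (s + k)))) with (exp (- (c * s)) * / exp (c * k)).
      2: { rewrite <- exp_Ropp, <- exp_plus; f_equal; ring. }
      assert (H5 := exp_pos (c * k)).
      assert (H6 : 1 <= exp (c * k)) by nra.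
      apply Rmult_le_reg_l with (exp (c * k)); trivial.
      replace (exp (c * k) * (exp (- (c * s)) * / exp (c * k) * norm (q (s + k))))
        with (exp (- (c * s)) * norm (q (s + k))) by (field; lra).
      assert (H7 : exp (- (c * s)) <= 1)
        by (rewrite <- exp_0; apply exp_monotone; nra).
      apply Rle_trans with
        (exp (- (c * s)) * (exp (c * k) * norm (q s) + k * eps)).
      + apply Rmult_le_compat_l; nra.
      + assert (0 <= k * eps) by nra.
        assert (exp (- (c * s)) * (k * eps) <= k * eps) by nra.
        assert (k * eps <= exp (c * k) * (k * eps)) by nra.
        nra. }
  rewrite Rmult_0_r, Ropp_0, exp_0, exp_Ropp in H.
  assert (Hp := exp_pos (c * t)).
  apply Rmult_le_reg_l with (/ exp (c * t)); [now apply Rinv_0_lt_compat|].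
  rewrite <- Rmult_assoc, Rinv_l; lra. }
intros t Ht; split; [now apply H|].
assert (H' : norm (minus (q t) (q 0)) - (exp (c * t) - 1) * norm (q 0)
  <= norm (minus (q 0) (q 0)) - (exp (c * 0) - 1) * norm (q 0)).
{ apply (nonincreasing_of_right_increments
    (fun s => norm (minus (q s) (q 0)) - (exp (c * s) - 1) * norm (q 0))); trivial.
  - intros s Hs eps Heps.
    destruct (Hleft s ltac:(lra) eps Heps) as [d [Hd H1]].
    exists d; split; trivial; intros k Hk Hks; specialize (H1 k Hk ltac:(lra)).
    assert (H2 := norm_minus_triangle (q (s - k)) (q s) (q 0)).
    assert (H3 : exp (c * (s - k)) <= exp (c * s)) by (apply exp_monotone; nra).
    assert (H4 := norm_ge_0 (q 0)).
    nra.
  - intros s Hs eps Heps.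
    destruct (Hright s ltac:(lra) eps Heps) as [d [Hd H1]].
    exists d; split; trivial; intros k Hk Hks; specialize (H1 k Hk).
    assert (H2 := norm_minus_triangle (q s) (q (s + k)) (q 0)).
    assert (H3 := exp_ineq1_le (c * k)).
    assert (H4 := norm_ge_0 (q 0)).
    assert (H5 := H s ltac:(lra)).
    assert (H6 := exp_pos (c * s)).
    rewrite Hexp.
    assert (H7 : k * c * norm (q s) <= k * c * (exp (c * s) * norm (q 0)))
      by (apply Rmult_le_compat_l; nra).
    assert (H8 : exp (c * s) * (1 + c * k) * norm (q 0) <=
                 exp (c * s) * exp (c * k) * norm (q 0)).
    { apply Rmult_le_compat_r; [trivial|]; apply Rmult_le_compat_l; lra. }
    nra. }
rewrite norm_minus_self, Rmult_0_r, exp_0 in H'; lra.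
Qed.

(** * The splitting and the semigroup *)

Section Splitting.
Context {X V : NormedModule R_AbsRing} (U : R -> X -> X) (i : V -> X)
  (A : X -> X) (Xm Xp : X -> Prop) (Pm : X -> X) (Pp : X -> V) (c : R).
Hypotheses (HX : seq_complete X) (HV : seq_complete V)
  (U_lin : forall t, 0 <= t -> is_linear (U t))
  (U_0 : forall x, U 0 x = x)
  (U_add : forall s t, 0 <= s -> 0 <= t -> forall x, U (s + t) x = U s (U t x))
  (U_cont : forall x, filterlim (fun t => U t x) (at_right 0) (locally x))
  (X_int : forall f : R -> X, (forall t, continuous f t) ->
     forall a b, exists I, is_RInt f a b I)
  (i_lin : is_linear i) (i_inj : forall v w, i v = i w -> v = w)
  (Xm_plus : forall x y, Xm x -> Xm y -> Xm (plus x y))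
  (Xm_scal : forall (a : R) x, Xm x -> Xm (scal a x))
  (Xm_closed : closed Xm)
  (Xp_plus : forall x y, Xp x -> Xp y -> Xp (plus x y))
  (Xp_scal : forall (a : R) x, Xp x -> Xp (scal a x))
  (Xp_closed : closed Xp)
  (Xmp : forall x, Xm x -> Xp x -> x = zero)
  (Pmp : forall x, Xm (Pm x) /\ Xp (i (Pp x)) /\ x = plus (Pm x) (i (Pp x)))
  (c_ge0 : 0 <= c)
  (A_deriv : forall w, Xp w -> right_deriv U w (A w))
  (A_bound : forall v, Xp (i v) ->
     exists v', i v' = A (i v) /\ norm v' <= c * norm v)
  (Xp_A : forall w, Xp w -> Xp (A w))
  (Xm_deriv : forall w y, Xm w -> right_deriv U w y -> Xm y)
  (Xm_contr : forall w t, Xm w -> 0 <= t -> norm (U t w) <= norm w).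

Lemma Xm_minus x y : Xm x -> Xm y -> Xm (minus x y).
Proof.
intros Hx Hy; replace (minus x y) with (plus x (scal (-1) y)) by module_eq; auto.
Qed.

Lemma Xp_minus x y : Xp x -> Xp y -> Xp (minus x y).
Proof.
intros Hx Hy; replace (minus x y) with (plus x (scal (-1) y)) by module_eq; auto.
Qed.

Lemma splitting_unique x a b :
  Xm a -> Xp (i b) -> x = plus a (i b) -> Pm x = a /\ Pp x = b.
Proof.
intros Ha Hb Hx; destruct (Pmp x) as [H1 [H2 H3]].
assert (Heq : minus (Pm x) a = minus (i b) (i (Pp x))).
{ replace (minus (Pm x) a)
    with (minus (plus (Pm x) (i (Pp x))) (plus a (i (Pp x)))) by module_eq.
  rewrite <- H3, Hx at 1; module_eq. }
assert (H0 : minus (Pm x) a = zero).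
{ apply Xmp; [now apply Xm_minus|]; rewrite Heq; now apply Xp_minus. }
split.
- replace (Pm x) with (plus (minus (Pm x) a) a) by module_eq.
  rewrite H0; apply plus_zero_l.
- apply i_inj; rewrite H0 in Heq.
  replace (i b) with (plus (minus (i b) (i (Pp x))) (i (Pp x))) by module_eq.
  rewrite <- Heq; symmetry; apply plus_zero_l.
Qed.

Lemma Pm_eq x : Pm x = minus x (i (Pp x)).
Proof.
destruct (Pmp x) as [_ [_ H]]; rewrite H at 2; module_eq.
Qed.

Lemma Pp_plus x y : Pp (plus x y) = plus (Pp x) (Pp y).
Proof.
destruct (Pmp x) as [H1 [H2 H3]]; destruct (Pmp y) as [H4 [H5 H6]].
apply (splitting_unique (plus x y) (plus (Pm x) (Pm y))).
- now apply Xm_plus.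
- rewrite (linear_plus i i_lin); now apply Xp_plus.
- rewrite (linear_plus i i_lin), H3, H6 at 1; module_eq.
Qed.

Lemma Pp_scal (k : R) x : Pp (scal k x) = scal k (Pp x).
Proof.
destruct (Pmp x) as [H1 [H2 H3]].
apply (splitting_unique (scal k x) (scal k (Pm x))).
- now apply Xm_scal.
- rewrite (linear_scal_R i i_lin); now apply Xp_scal.
- rewrite (linear_scal_R i i_lin), H3 at 1; module_eq.
Qed.

(** The graph is closed in [X] times [V]: if [u n] tends to [x] and [Pp (u n)] to [v], continuity of
    [i] and closedness of both subspaces make [(x - i v) + i v] the splitting of [x]. Boundedness is
    thus obtained for the norm of [V] on the target. *)
Lemma Pp_linear : is_linear Pp.
Proof.
apply closed_graph; trivial; [apply Pp_plus|apply Pp_scal|].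
intros u x v Hu Hv.
assert (Hiv : filterlim (fun n => i (Pp (u n))) eventually (locally (i v))).
{ eapply filterlim_comp; [exact Hv|exact (linear_cont i v i_lin)]. }
apply (splitting_unique x (minus x (i v))).
- eapply (closed_filterlim (F := eventually)); [exact (lim_minus _ _ _ _ _ Hu Hiv)| |exact Xm_closed].
  intros n; generalize (proj1 (Pmp (u n))); rewrite Pm_eq; trivial.
- eapply (closed_filterlim (F := eventually)); [exact Hiv| |exact Xp_closed].
  intros n; apply Pmp.
- module_eq.
Qed.

Lemma Pm_linear : is_linear Pm.
Proof.
assert (H := Pp_linear); split.
- intros x y; rewrite !Pm_eq, (linear_plus Pp H), (linear_plus i i_lin); module_eq.
- intros k x; rewrite !Pm_eq, (linear_scal_R Pp H), (linear_scal_R i i_lin); module_eq.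
- destruct (linear_norm _ H) as [C [HC HP]].
  destruct (linear_norm _ i_lin) as [C' [HC' Hi]].
  exists (1 + C' * C); split; [nra|]; intros x; rewrite Pm_eq.
  eapply Rle_trans; [apply norm_minus_le|].
  specialize (Hi (Pp x)); specialize (HP x); nra.
Qed.

Lemma Pp_Xm x : Xm x -> Pp x = zero.
Proof.
intros Hx; apply (splitting_unique x x); trivial.
- rewrite (linear_zero i i_lin).
  replace (zero : X) with (scal 0 (i (Pp x))) by module_eq; apply Xp_scal, Pmp.
- rewrite (linear_zero i i_lin); symmetry; apply plus_zero_r.
Qed.

Lemma Pm_Xp x : Xp x -> Pm x = zero.
Proof.
intros Hx; apply Xmp; [apply Pmp|]; rewrite Pm_eq.
apply Xp_minus; [trivial|apply Pmp].
Qed.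

Lemma Xm_of_Pp_zero x : Pp x = zero -> Xm x.
Proof.
intros H; replace x with (Pm x); [apply Pmp|].
rewrite Pm_eq, H, (linear_zero i i_lin); module_eq.
Qed.

Lemma Xp_of_Pm_zero x : Pm x = zero -> Xp x.
Proof.
intros H; replace x with (i (Pp x)); [apply Pmp|].
destruct (Pmp x) as [_ [_ Hx]]; rewrite Hx at 2; rewrite H.
symmetry; apply plus_zero_l.
Qed.

(** Since [Xp] lies in the domain, [Pm x] lies there too, and its derivative stays in [Xm]. Hence
    [i (Pp y)] equals [A (i (Pp x))], and the bound on [A] over [Xp] applies. *)
Lemma Pp_right_deriv_bound x y : right_deriv U x y ->
  norm (Pp y) <= c * norm (Pp x).
Proof.
intros H; destruct (Pmp x) as [H1 [H2 _]].
destruct (A_bound (Pp x) H2) as [v [Hv Hvn]].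
replace (Pp y) with v; [trivial|]; symmetry.
apply (splitting_unique y (minus y (A (i (Pp x))))).
- apply Xm_deriv with (Pm x); trivial; rewrite Pm_eq.
  apply right_deriv_minus; auto.
- rewrite Hv; auto.
- rewrite Hv; module_eq.
Qed.

Lemma Pp_semigroup_domain x y : right_deriv U x y -> forall t, 0 <= t ->
  norm (Pp (U t x)) <= exp (c * t) * norm (Pp x) /\
  norm (minus (Pp (U t x)) (Pp x)) <= (exp (c * t) - 1) * norm (Pp x).
Proof.
intros Hxy t Ht.
destruct (linear_norm _ Pp_linear) as [C [HC HP]].
assert (H := exp_growth V (fun s => Pp (U s x)) c c_ge0); cbv beta in H.
rewrite U_0 in H; apply H; trivial.
- intros s Hs eps Heps.
  destruct (semigroup_left_cont U HX U_lin U_0 U_add U_cont s x Hs (eps / C))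
    as [d [Hd H1]]; [now apply Rdiv_lt_0_compat|].
  exists d; split; trivial; intros k Hk Hks; specialize (H1 k Hk Hks).
  rewrite <- (linear_minus Pp) by apply Pp_linear.
  eapply Rle_trans; [apply HP|].
  replace eps with (C * (eps / C)) by (field; lra).
  apply Rmult_le_compat_l; [lra|left; exact H1].
- intros s Hs eps Heps.
  assert (Hd := right_deriv_semigroup U U_lin U_add s x y Hs Hxy).
  destruct (Hd (eps / C)) as [d [Hd0 H1]]; [now apply Rdiv_lt_0_compat|].
  exists d; split; trivial; intros k Hk; specialize (H1 k Hk).
  rewrite Rplus_comm, U_add by lra.
  assert (H2 := HP (minus (minus (U k (U s x)) (U s x)) (scal k (U s y)))).
  rewrite !(linear_minus Pp), (linear_scal_R Pp) in H2 by apply Pp_linear.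
  assert (H3 := norm_le_minus (minus (Pp (U k (U s x))) (Pp (U s x)))
                  (scal k (Pp (U s y)))).
  rewrite norm_scal_pos in H3 by lra.
  assert (H4 := Pp_right_deriv_bound _ _ Hd).
  assert (H5 : k * norm (Pp (U s y)) <= k * (c * norm (Pp (U s x))))
    by (apply Rmult_le_compat_l; lra).
  assert (H6 : C * norm (minus (minus (U k (U s x)) (U s x)) (scal k (U s y)))
               <= k * eps).
  { replace (k * eps) with (C * (k * (eps / C))) by (field; lra).
    apply Rmult_le_compat_l; [lra|exact H1]. }
  lra.
Qed.

(** Both sides depend on [x] through bounded operators, so the estimates extend from the domain by
    density. *)
Lemma Pp_semigroup x t : 0 <= t ->
  norm (Pp (U t x)) <= exp (c * t) * norm (Pp x) /\
  norm (minus (Pp (U t x)) (Pp x)) <= (exp (c * t) - 1) * norm (Pp x).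
Proof.
intros Ht.
assert (HL := Pp_linear).
assert (HUt := U_lin t Ht).
assert (Hexp : 1 <= exp (c * t)) by (rewrite <- exp_0; apply exp_monotone; nra).
assert (Hdense : forall x eps, 0 < eps ->
  exists x', (exists y', right_deriv U x' y') /\ norm (minus x' x) < eps).
{ intros x0 eps Heps.
  destruct (domain_dense U HX U_lin U_0 U_add U_cont X_int x0 eps Heps)
    as [x' [y' [H1 H2]]]; exists x'; split; trivial; now exists y'. }
assert (Hcomp : is_linear (fun x => Pp (U t x))).
{ split.
  - intros a b; rewrite (linear_plus (U t) HUt); apply HL.
  - intros k a; rewrite (linear_scal_R (U t) HUt); apply HL.
  - destruct (linear_norm _ HL) as [C [HC HP]].
    destruct (linear_norm _ HUt) as [C' [HC' HU']].
    exists (C * C'); split; [nra|]; intros a.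
    specialize (HP (U t a)); specialize (HU' a); nra. }
split; revert x; apply (dense_norm_le X V V (fun x => exists y, right_deriv U x y));
  trivial; try lra.
- intros x [y Hy]; now apply (Pp_semigroup_domain x y).
- destruct (linear_norm _ HL) as [C [HC HP]].
  destruct (linear_norm _ Hcomp) as [C' [HC' HP']].
  split.
  + intros a b; rewrite (linear_plus _ Hcomp), (linear_plus Pp HL); module_eq.
  + intros k a; rewrite (linear_scal_R _ Hcomp), (linear_scal_R Pp HL); module_eq.
  + exists (C + C'); split; [lra|]; intros a.
    eapply Rle_trans; [apply norm_minus_le|].
    specialize (HP a); specialize (HP' a); lra.
- intros x [y Hy]; now apply (Pp_semigroup_domain x y).
Qed.

Lemma norm_le_0_zero (W : NormedModule R_AbsRing) (w : W) : norm w <= 0 -> w = zero.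
Proof. intros H; apply norm_eq_zero; generalize (norm_ge_0 w); lra. Qed.

(** Uniqueness in the form of the growth bound: if [Pp x] vanishes, so does [Pp (U t x)]. *)
Lemma semigroup_Xm x t : 0 <= t -> Xm x -> Xm (U t x).
Proof.
intros Ht Hx; apply Xm_of_Pp_zero, norm_le_0_zero.
generalize (proj1 (Pp_semigroup x t Ht)); rewrite (Pp_Xm x Hx), norm_zero; lra.
Qed.

(* [|Pm U(s) x|] has nonpositive right derivative: [U] contracts [Xm], and [Pm]
   annihilates the generator on [Xp]. *)
Lemma semigroup_Xp x t : 0 <= t -> Xp x -> Xp (U t x).
Proof.
intros Ht Hx; apply Xp_of_Pm_zero, norm_le_0_zero.
destruct (linear_norm _ Pm_linear) as [C [HC HP]].
assert (H0 : norm (Pm (U 0 x)) = 0) by (rewrite U_0, Pm_Xp by trivial; apply norm_zero).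
rewrite <- H0.
apply (nonincreasing_of_right_increments (fun s => norm (Pm (U s x)))); trivial.
- intros s Hs eps Heps.
  destruct (semigroup_left_cont U HX U_lin U_0 U_add U_cont s x (proj1 Hs) (eps / C))
    as [d [Hd H1]]; [now apply Rdiv_lt_0_compat|].
  exists d; split; trivial; intros k Hk Hks; specialize (H1 k Hk ltac:(lra)).
  assert (H2 := norm_le_minus (Pm (U s x)) (Pm (U (s - k) x))).
  rewrite <- (linear_minus Pm) in H2 by apply Pm_linear.
  specialize (HP (minus (U s x) (U (s - k) x))).
  assert (H3 : C * norm (minus (U s x) (U (s - k) x)) <= C * (eps / C))
    by (apply Rmult_le_compat_l; lra).
  replace (C * (eps / C)) with eps in H3 by (field; lra); lra.
- intros s Hs eps Heps.
  set (w := i (Pp (U s x))).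
  assert (Hw : Xp w) by apply Pmp.
  destruct (A_deriv w Hw (eps / C)) as [d [Hd H1]]; [now apply Rdiv_lt_0_compat|].
  exists d; split; trivial; intros k Hk _; specialize (H1 k Hk).
  rewrite Rplus_comm, U_add by lra.
  set (a := Pm (U s x)).
  assert (Ha : Xm a) by apply Pmp.
  replace (U s x) with (plus a w) by (symmetry; apply Pmp).
  rewrite (linear_plus (U k)), (linear_plus Pm)
    by first [apply U_lin; lra|apply Pm_linear].
  eapply Rle_trans; [apply norm_triangle|].
  apply Rplus_le_compat.
  + replace (Pm (U k a)) with (U k a); [apply Xm_contr; [trivial|lra]|].
    rewrite Pm_eq, Pp_Xm by (apply semigroup_Xm; [lra|trivial]).
    rewrite (linear_zero i i_lin); module_eq.
  + replace (Pm (U k w)) with (Pm (minus (minus (U k w) w) (scal k (A w)))).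
    2: { rewrite !(linear_minus Pm), (linear_scal_R Pm) by apply Pm_linear.
         rewrite (Pm_Xp w Hw), (Pm_Xp (A w) (Xp_A w Hw)); module_eq. }
    eapply Rle_trans; [apply HP|].
    replace (k * eps) with (C * (k * (eps / C))) by (field; lra).
    apply Rmult_le_compat_l; [lra|exact H1].
Qed.

Lemma Pm_semigroup x t : 0 <= t -> Pm (U t x) = U t (Pm x).
Proof.
intros Ht; assert (Hl := U_lin t Ht).
rewrite Pm_eq, Pm_eq, (linear_minus (U t)) by trivial; do 2 f_equal.
destruct (splitting_unique (U t x) (U t (Pm x)) (Pp (U t (i (Pp x))))) as [_ H].
- apply semigroup_Xm; [trivial|apply Pmp].
- apply Pmp.
- replace (i (Pp (U t (i (Pp x))))) with (U t (i (Pp x))).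
  + rewrite <- (linear_plus (U t) Hl); f_equal; apply Pmp.
  + destruct (Pmp (U t (i (Pp x)))) as [_ [_ Heq]]; rewrite Heq at 1.
    rewrite Pm_Xp by (apply semigroup_Xp; [trivial|apply Pmp]); apply plus_zero_l.
- rewrite H; destruct (Pmp (U t (i (Pp x)))) as [_ [_ Heq]]; rewrite Heq at 2.
  rewrite Pm_Xp by (apply semigroup_Xp; [trivial|apply Pmp]).
  symmetry; apply plus_zero_l.
Qed.

End Splitting.

(** * Periodic mild solutions *)

Lemma exp_right_deriv (c eta : R) : 0 <= c -> 0 < eta -> exists d, 0 < d /\
  forall k, 0 < k < d -> exp (c * k) - 1 <= k * (c + eta) /\ exp (c * k) <= 1 + eta.
Proof.
intros Hc He.
assert (Hden : 0 < (c + eta) * (c + 1) + 1) by nra.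
(* The denominator is at least [c (c + eta)] and at least [c + eta]. The first makes
   [(1 + k (c + eta)) (1 - c k) >= 1], which dominates [exp (c k) (1 - c k) <= 1]; the second makes
   [k (c + eta) <= eta]. *)
exists (eta / ((c + eta) * (c + 1) + 1)); split; [now apply Rdiv_lt_0_compat|].
intros k [Hk0 Hk].
assert (Hk1 : k * ((c + eta) * (c + 1) + 1) < eta).
{ apply Rmult_lt_compat_r with (r := (c + eta) * (c + 1) + 1) in Hk; trivial.
  replace (eta / ((c + eta) * (c + 1) + 1) * ((c + eta) * (c + 1) + 1))
    with eta in Hk by (field; lra); exact Hk. }
assert (Hkc : 0 <= k * c) by nra.
assert (Hkce : 0 <= k * c * (c + eta)) by nra.
assert (Hc1 : c * k < 1).
{ assert (k * (c + eta) * c < eta) by nra.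
  apply Rnot_le_lt; intros Hn.
  assert (c + eta <= c * k * (c + eta)) by nra. nra. }
assert (H1 : exp (c * k) * (1 - c * k) <= 1).
{ assert (H := exp_ineq1_le (- (c * k))).
  assert (Hp := exp_pos (c * k)).
  assert (Hi : exp (c * k) * exp (- (c * k)) = 1)
    by (rewrite <- exp_plus, Rplus_opp_r; apply exp_0).
  nra. }
assert (H2 : exp (c * k) <= 1 + k * (c + eta)).
{ apply Rmult_le_reg_r with (1 - c * k); [lra|].
  apply Rle_trans with 1; [exact H1|].
  assert (k * (k * (c + eta) * c) <= k * eta) by nra. nra. }
split; [lra|]; nra.
Qed.

Lemma continuous_norm_comp {V : NormedModule R_AbsRing} (f : R -> V) (t : R) :
  continuous f t -> continuous (fun s => norm (f s)) t.
Proof.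
intros Hf; apply continuous_R_iff; intros eps Heps.
destruct (proj1 (continuous_norm_iff f t) Hf eps Heps) as [d [Hd H]].
exists d; split; trivial; intros s Hs; specialize (H s Hs).
assert (H1 := norm_le_minus (f s) (f t)).
assert (H2 := norm_le_minus (f t) (f s)); rewrite norm_minus_sym in H2.
apply Rabs_def1; lra.
Qed.

Lemma continuous_linear_comp {V W : NormedModule R_AbsRing} (l : V -> W) (f : R -> V)
    (t : R) : is_linear l -> continuous f t -> continuous (fun s => l (f s)) t.
Proof.
intros Hl Hf; exact (continuous_comp f l t Hf (linear_cont l (f t) Hl)).
Qed.

Lemma continuous_minus_comp {V : NormedModule R_AbsRing} (f g : R -> V) (t : R) :
  continuous f t -> continuous g t -> continuous (fun s => minus (f s) (g s)) t.
Proof. intros Hf Hg; exact (continuous_minus f g t Hf Hg). Qed.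

Lemma RInt_periodic (f : R -> R) (T c : R) :
  (forall t, continuous f t) -> (forall t, f (t + T) = f t) ->
  RInt (fun t => f (t + c)) 0 T = RInt f 0 T.
Proof.
intros Hf Hper; apply (is_RInt_unique (V := R_CompleteNormedModule)).
assert (Hex : forall a b, ex_RInt f a b).
{ intros a b; apply (ex_RInt_continuous (V := R_CompleteNormedModule)); auto. }
apply (is_RInt_periodic (V := R_NormedModule) f T c); trivial.
apply (RInt_correct (V := R_CompleteNormedModule)), Hex.
Qed.

Lemma RInt_linear_comb (f g : R -> R) (a b r s : R) :
  (forall t, continuous f t) -> (forall t, continuous g t) ->
  RInt (fun t => r * f t + s * g t) a b = r * RInt f a b + s * RInt g a b.
Proof.
intros Hf Hg; apply (is_RInt_unique (V := R_CompleteNormedModule)).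
apply (is_RInt_plus (V := R_NormedModule)); apply (is_RInt_scal (V := R_NormedModule));
  apply (RInt_correct (V := R_CompleteNormedModule));
  apply (ex_RInt_continuous (V := R_CompleteNormedModule)); auto.
Qed.

Lemma continuous_linear_comb (f g : R -> R) (r s t : R) :
  continuous f t -> continuous g t -> continuous (fun x => r * f x + s * g x) t.
Proof.
intros Hf Hg.
apply (continuous_plus (V := R_NormedModule) (fun x => r * f x) (fun x => s * g x));
  apply (continuous_scal_r (V := R_NormedModule)); trivial.
Qed.

Lemma norm_is_RInt_le {V W : NormedModule R_AbsRing} (f : R -> V) (y : R -> W)
    (a b K : R) (I : V) :
  a <= b -> (forall t, continuous y t) ->
  (forall s, a <= s <= b -> norm (f s) <= K * norm (y s)) ->
  is_RInt f a b I -> norm I <= K * RInt (fun s => norm (y s)) a b.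
Proof.
intros Hab Hy Hf HI.
apply (norm_RInt_le f (fun s => K * norm (y s)) a b I); trivial.
apply (is_RInt_scal (V := R_NormedModule)).
apply (RInt_correct (V := R_CompleteNormedModule)).
apply ex_RInt_continuous_on; trivial; intros s _; now apply continuous_norm_comp.
Qed.

(** * The component in the unstable subspace *)

Section UnstablePart.
Context {X V : NormedModule R_AbsRing} (U : R -> X -> X) (i : V -> X)
  (Pp : X -> V) (y : R -> V) (g : R -> X) (c K L T : R).
Hypotheses (i_lin : is_linear i) (Pp_lin : is_linear Pp) (c_ge0 : 0 <= c)
  (K_ge0 : 0 <= K) (L_ge0 : 0 <= L) (T_gt0 : 0 < T)
  (Pp_norm : forall x, norm (Pp x) <= K * norm x)
  (Pp_growth : forall x t, 0 <= t ->
     norm (Pp (U t x)) <= exp (c * t) * norm (Pp x) /\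
     norm (minus (Pp (U t x)) (Pp x)) <= (exp (c * t) - 1) * norm (Pp x))
  (y_cont : forall t, continuous y t)
  (g_le : forall t, norm (g t) <= L * norm (y t))
  (mild : forall t0 t, t0 < t -> exists I,
     is_RInt (fun s => U (t - s) (g s)) t0 t I /\
     i (y t) = plus (U (t - t0) (i (y t0))) I)
  (mean_zero : is_RInt y 0 T zero).

Definition unstable_part (t : R) : V := Pp (i (y t)).

Lemma unstable_part_continuous t : continuous unstable_part t.
Proof.
apply (continuous_linear_comp Pp (fun s => i (y s))); trivial.
now apply continuous_linear_comp.
Qed.

(** The variation of constants formula under [Pp]: the second growth bound controls the drift of the
    homogeneous term, the first one the forcing. *)
Lemma unstable_part_step t k : 0 < k ->
  norm (minus (unstable_part (t + k)) (unstable_part t)) <=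
    (exp (c * k) - 1) * norm (unstable_part t) +
    exp (c * k) * K * L * RInt (fun s => norm (y s)) t (t + k).
Proof.
intros Hk; destruct (mild t (t + k) ltac:(lra)) as [I [HI Heq]].
unfold unstable_part at 1; rewrite Heq, (linear_plus Pp Pp_lin).
replace (t + k - t) with k by ring.
replace (minus (plus (Pp (U k (i (y t)))) (Pp I)) (unstable_part t))
  with (plus (minus (Pp (U k (i (y t)))) (unstable_part t)) (Pp I)) by module_eq.
eapply Rle_trans; [apply norm_triangle|].
apply Rplus_le_compat.
- apply (proj2 (Pp_growth (i (y t)) k ltac:(lra))).
- apply (norm_is_RInt_le (fun s => Pp (U (t + k - s) (g s)))); try lra; trivial.
  + intros s Hs.
    destruct (Pp_growth (g s) (t + k - s) ltac:(lra)) as [H _].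
    assert (H1 : exp (c * (t + k - s)) <= exp (c * k)) by (apply exp_monotone; nra).
    assert (H2 := Pp_norm (g s)); specialize (g_le s).
    assert (H3 := norm_ge_0 (Pp (g s))); assert (H4 := exp_pos (c * k)).
    apply Rle_trans with (exp (c * k) * norm (Pp (g s))); [nra|].
    rewrite !Rmult_assoc; apply Rmult_le_compat_l; nra.
  + exact (is_RInt_linear _ _ Pp _ _ _ _ Pp_lin HI).
Qed.

Let rate (t : R) : R := c * norm (unstable_part t) + K * L * norm (y t).

Lemma rate_continuous t : continuous rate t.
Proof.
apply continuous_linear_comb; apply continuous_norm_comp; trivial.
apply unstable_part_continuous.
Qed.

Lemma rate_ge0 t : 0 <= rate t.
Proof.
assert (H1 := norm_ge_0 (unstable_part t)); assert (H2 := norm_ge_0 (y t)).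
unfold rate; assert (0 <= K * L) by nra; nra.
Qed.

Lemma unstable_part_increment a b : a <= b ->
  norm (minus (unstable_part b) (unstable_part a)) <= RInt rate a b.
Proof.
intros Hab.
assert (H : norm (minus (unstable_part b) (unstable_part a)) <=
  norm (minus (unstable_part a) (unstable_part a)) + RInt rate a b).
{ apply (increment_le_RInt (fun t => norm (minus (unstable_part t) (unstable_part a))));
    trivial.
  - intros s _; apply rate_continuous.
  - intros s Hs eps Heps.
    destruct (proj1 (continuous_norm_iff _ _) (unstable_part_continuous s) eps Heps)
      as [d [Hd H]].
    exists d; split; trivial; intros k Hk _.
    specialize (H (s - k)); rewrite norm_minus_sym in H.
    assert (Hk' : Rabs (s - k - s) < d) by (apply Rabs_def1; lra).
    specialize (H Hk').
    generalize (norm_minus_triangle (unstable_part (s - k)) (unstable_part s)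
                  (unstable_part a)); lra.
  - intros s Hs eps Heps.
    assert (Ha := norm_ge_0 (unstable_part s)); assert (Hb := norm_ge_0 (y s)).
    assert (HKL : 0 <= K * L) by nra.
    (* The error per unit of time is at most [eta w]: [eta |y+|] from the drift and, as
       [eta * eta <= eta], [eta K L (2 + |y|)] from the forcing; the added 1 makes [w] positive. *)
    set (w := norm (unstable_part s) + K * L * (2 + norm (y s)) + 1).
    assert (Hw : 0 < w) by (unfold w; nra).
    set (eta := Rmin 1 (eps / w)).
    assert (He1 : eta <= 1) by apply Rmin_l.
    assert (He2 : eta * w <= eps).
    { replace eps with (eps / w * w) by (field; lra).
      apply Rmult_le_compat_r; [lra|apply Rmin_r]. }
    assert (He0 : 0 < eta)
      by (apply Rmin_glb_lt; [lra|now apply Rdiv_lt_0_compat]).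
    destruct (exp_right_deriv c eta c_ge0 He0) as [d1 [Hd1 H1]].
    destruct (proj1 (continuous_R_iff _ _)
      (continuous_norm_comp y s (y_cont s)) eta He0) as [d2 [Hd2 H2]].
    exists (Rmin d1 d2); split; [now apply Rmin_glb_lt|].
    intros k [Hk0 Hk] _; apply Rmin_Rgt_l in Hk; destruct Hk as [Hk1 Hk2].
    destruct (H1 k ltac:(lra)) as [H3 H4].
    assert (H5 := unstable_part_step s k Hk0).
    assert (H6 := norm_minus_triangle (unstable_part s) (unstable_part (s + k))
                    (unstable_part a)).
    assert (H7 : RInt (fun r => norm (y r)) s (s + k) <= (s + k - s) * (norm (y s) + eta)).
    { apply RInt_le_const; [lra| |].
      - apply ex_RInt_continuous_on; [lra|]; intros r _; now apply continuous_norm_comp.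
      - intros r Hr; specialize (H2 r); apply Rabs_def2 in H2; [lra|].
        apply Rabs_def1; lra. }
    replace (s + k - s) with k in H7 by ring.
    assert (H8 : (exp (c * k) - 1) * norm (unstable_part s) <=
                 k * (c + eta) * norm (unstable_part s))
      by (apply Rmult_le_compat_r; lra).
    assert (Hexp := exp_pos (c * k)).
    assert (H9 : exp (c * k) * K * L * RInt (fun r => norm (y r)) s (s + k) <=
                 (1 + eta) * (K * L) * (k * (norm (y s) + eta))).
    { apply Rle_trans with (exp (c * k) * (K * L) * (k * (norm (y s) + eta))).
      - rewrite !Rmult_assoc; repeat apply Rmult_le_compat_l; lra.
      - apply Rmult_le_compat_r; [nra|]; apply Rmult_le_compat_r; lra. }
    assert (H10 : k * (eta * w) <= k * eps) by (apply Rmult_le_compat_l; lra).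
    assert (H11 : eta * eta <= eta) by nra.
    assert (H12 : k * (K * L * (eta * eta)) <= k * (K * L * eta))
      by (repeat apply Rmult_le_compat_l; lra).
    unfold rate; unfold w in H10.
    assert (0 <= k * eta) by nra.
    nra. }
rewrite norm_minus_self in H; lra.
Qed.

Lemma unstable_part_mean_zero : is_RInt unstable_part 0 T zero.
Proof.
assert (H := is_RInt_linear _ _ Pp _ _ _ _ Pp_lin
               (is_RInt_linear _ _ i _ _ _ _ i_lin mean_zero)).
rewrite (linear_zero i i_lin), (linear_zero Pp Pp_lin) in H; exact H.
Qed.

Lemma unstable_part_L1 :
  (1 - c * T) * RInt (fun t => norm (unstable_part t)) 0 T <=
  T * (K * L * RInt (fun t => norm (y t)) 0 T).
Proof.
assert (Hrex : forall a b, a <= b -> ex_RInt rate a b).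
{ intros a b Hab; apply ex_RInt_continuous_on; trivial; intros s _.
  apply rate_continuous. }
assert (Hmono : forall a b, 0 <= a <= b -> b <= T -> RInt rate a b <= RInt rate 0 T).
{ intros a b H1 H2.
  assert (Hc : forall s, continuous rate s) by apply rate_continuous.
  rewrite <- (RInt_Chasles_on rate 0 a T), <- (RInt_Chasles_on rate a b T)
    by (auto; lra).
  assert (Hnn : forall u v, u <= v -> 0 <= RInt rate u v).
  { intros u v Huv; rewrite <- (Rmult_0_r (v - u)).
    apply RInt_ge_const; auto; intros s _; apply rate_ge0. }
  generalize (Hnn 0 a ltac:(lra)) (Hnn b T ltac:(lra)); lra. }
assert (Hdiff : forall t s, 0 <= t <= T -> 0 <= s <= T ->
  norm (minus (unstable_part t) (unstable_part s)) <= RInt rate 0 T).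
{ intros t s Ht Hs; destruct (Rle_dec s t) as [H|H].
  - eapply Rle_trans; [now apply unstable_part_increment|apply Hmono; lra].
  - rewrite norm_minus_sym.
    eapply Rle_trans; [apply unstable_part_increment; lra|apply Hmono; lra]. }
(* Averaging over [s] uses that the unstable part has mean zero. *)
assert (Hsup : forall t, 0 <= t <= T -> norm (unstable_part t) <= RInt rate 0 T).
{ intros t Ht.
  assert (HI : is_RInt (fun s => minus (unstable_part t) (unstable_part s)) 0 T
                 (minus (scal (T - 0) (unstable_part t)) (zero : V))).
  { apply (is_RInt_minus (V := V)); [apply (is_RInt_const (V := V))|].
    exact unstable_part_mean_zero. }
  apply (norm_RInt_le_const _ 0 T _ (RInt rate 0 T)) in HI;
    [|lra|intros s Hs; now apply Hdiff].
  replace (minus (scal (T - 0) (unstable_part t)) (zero : V))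
    with (scal T (unstable_part t)) in HI by module_eq.
  rewrite norm_scal_pos, Rminus_0_r in HI by lra.
  now apply Rmult_le_reg_l in HI. }
assert (H : RInt (fun t => norm (unstable_part t)) 0 T <= (T - 0) * RInt rate 0 T).
{ apply RInt_le_const; trivial; [lra|].
  apply ex_RInt_continuous_on; [lra|]; intros s _.
  apply continuous_norm_comp, unstable_part_continuous. }
unfold rate in H; rewrite RInt_linear_comb in H.
- nra.
- intros t; apply continuous_norm_comp, unstable_part_continuous.
- intros t; now apply continuous_norm_comp.
Qed.

End UnstablePart.

(** * The component in the stable subspace *)

Lemma uniform_on_segment (P : R -> R -> Prop) (a b : R) :
  (forall t, a <= t <= b -> exists d, 0 < d /\
     forall t' s, a <= t' <= b -> Rabs (t' - t) < d -> 0 < s < d -> P s t') ->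
  exists d, 0 < d /\ forall s t, 0 < s < d -> a <= t <= b -> P s t.
Proof.
intros H.
assert (H' : forall t, exists d : posreal, a <= t <= b ->
  forall t' s, a <= t' <= b -> Rabs (t' - t) < d -> 0 < s < d -> P s t').
{ intros t; destruct (classic (a <= t <= b)) as [Ht|Ht].
  - destruct (H t Ht) as [d [Hd Hd']]; exists (mkposreal d Hd); intros _; exact Hd'.
  - exists (mkposreal 1 Rlt_0_1); contradiction. }
pose (delta := fun t => proj1_sig (constructive_indefinite_description _ (H' t))).
assert (Hdelta : forall t, a <= t <= b -> forall t' s, a <= t' <= b ->
  Rabs (t' - t) < delta t -> 0 < s < delta t -> P s t').
{ intros t; unfold delta; apply proj2_sig. }
(* Compactness yields a [d] such that every point of the segment is within [delta t0] of some [t0]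
   with [d <= delta t0]; it states this under a double negation. *)
destruct (compactness_value_1d a b delta) as [d Hd].
exists d; split; [apply cond_pos|]; intros s t Hs Ht.
apply NNPP; intros Hn; apply (Hd t Ht); intros [t0 [Ht0 [H1 H2]]]; apply Hn.
apply (Hdelta t0); trivial; lra.
Qed.

Section StablePart.
Context {X V : NormedModule R_AbsRing} (U : R -> X -> X) (UV : R -> V -> V)
  (i : V -> X) (Xm : X -> Prop) (Pm : X -> X) (Pp : X -> V)
  (y : R -> V) (g : R -> X) (m : R -> R) (mu K L T : R).
Hypotheses (i_lin : is_linear i) (i_inj : forall v w, i v = i w -> v = w)
  (U_lin : forall t, 0 <= t -> is_linear (U t))
  (U_add : forall s t, 0 <= s -> 0 <= t -> forall x, U (s + t) x = U s (U t x))
  (UV_lin : forall t, 0 <= t -> is_linear (UV t))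
  (UV_0 : forall v, UV 0 v = v)
  (UV_cont : forall v, filterlim (fun t => UV t v) (at_right 0) (locally v))
  (i_UV : forall t v, 0 <= t -> i (UV t v) = U t (i v))
  (Pp_lin : is_linear Pp) (Pm_lin : is_linear Pm)
  (Pm_eq : forall x, Pm x = minus x (i (Pp x)))
  (Xm_Pm : forall x, Xm (Pm x))
  (Pm_U : forall x t, 0 <= t -> Pm (U t x) = U t (Pm x))
  (mu_gt0 : 0 < mu) (K_ge0 : 0 <= K) (L_ge0 : 0 <= L) (T_gt0 : 0 < T)
  (Pm_norm : forall x, norm (Pm x) <= K * norm x)
  (Xm_contr : forall w t, Xm w -> 0 <= t -> norm (U t w) <= norm w)
  (Xm_V : forall v t, Xm (i v) -> 0 <= t ->
     norm (UV t v) <= exp (- (mu * t)) * norm v)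
  (Xm_XV : forall w v t, Xm w -> 0 < t -> i v = U t w ->
     norm v <= m t * exp (- (mu * t)) * norm w)
  (V_smoothing : forall w t, Xm w -> 0 < t -> exists v, i v = U t w)
  (U_Xm : forall w t, Xm w -> 0 <= t -> Xm (U t w))
  (m_pos : forall t, 0 < t -> 0 < m t)
  (m_cont : forall t, 0 < t -> continuous m t)
  (y_cont : forall t, continuous y t)
  (y_per : forall t, y (t + T) = y t)
  (g_le : forall t, norm (g t) <= L * norm (y t))
  (mild : forall t0 t, t0 < t -> exists I,
     is_RInt (fun s => U (t - s) (g s)) t0 t I /\
     i (y t) = plus (U (t - t0) (i (y t0))) I).

(** The subtraction takes place in [V], since [Pm] takes its values in [X]. *)
Definition stable_part (t : R) : V := minus (y t) (Pp (i (y t))).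

Lemma i_stable_part t : i (stable_part t) = Pm (i (y t)).
Proof. unfold stable_part; rewrite (linear_minus i) by trivial; now rewrite Pm_eq. Qed.

Lemma Xm_i_stable_part t : Xm (i (stable_part t)).
Proof. rewrite i_stable_part; apply Xm_Pm. Qed.

Lemma Xm_i_stable_part_minus t s : Xm (i (minus (stable_part t) (stable_part s))).
Proof.
rewrite (linear_minus i), !i_stable_part by trivial.
rewrite <- (linear_minus Pm) by trivial; apply Xm_Pm.
Qed.

Lemma stable_part_continuous t : continuous stable_part t.
Proof.
apply continuous_minus_comp; trivial.
apply (continuous_linear_comp Pp (fun s => i (y s))); trivial.
now apply continuous_linear_comp.
Qed.

Lemma stable_part_periodic t : stable_part (t + T) = stable_part t.
Proof. unfold stable_part; now rewrite y_per. Qed.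

Lemma propagated_continuous s : 0 <= s ->
  forall t, continuous (fun r => norm (UV s (stable_part r))) t.
Proof.
intros Hs t; apply continuous_norm_comp, continuous_linear_comp; auto.
apply stable_part_continuous.
Qed.

(** This is [Phi]; at [s = 0] it is the integral of [|y-|]. *)
Definition propagated_L1 (s : R) : R :=
  RInt (fun t => norm (UV s (stable_part t))) 0 T.

(** The difference [UV s (y- (t)) - UV (s + k) (y- (t - k))] is [U s (Pm I)], with [I] the integral
    term over [[t - k, t]]. The norm of [Pm I] in [X] is estimated first, and the passage to [V]
    costs [p] only once, outside the integral. *)
Lemma stable_part_step p s k t : 0 <= s -> 0 < k ->
  (forall w v, Xm w -> i v = U s w -> norm v <= p * norm w) -> 0 <= p ->
  norm (UV s (stable_part t)) <= norm (UV (s + k) (stable_part (t - k))) +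
    p * K * L * RInt (fun r => norm (y r)) (t - k) t.
Proof.
intros Hs Hk Hp Hp0; destruct (mild (t - k) t ltac:(lra)) as [I [HI Heq]].
replace (t - (t - k)) with k in Heq by ring.
eapply Rle_trans;
  [apply (norm_le_minus _ (UV (s + k) (stable_part (t - k))))|].
apply Rplus_le_compat_l.
assert (HPI : norm (Pm I) <= K * L * RInt (fun r => norm (y r)) (t - k) t).
{ apply (norm_is_RInt_le (fun r => Pm (U (t - r) (g r)))); trivial; [lra| |].
  - intros r Hr; rewrite Pm_U by lra.
    eapply Rle_trans; [apply Xm_contr; [apply Xm_Pm|lra]|].
    specialize (Pm_norm (g r)); specialize (g_le r).
    assert (K * norm (g r) <= K * (L * norm (y r)))
      by (apply Rmult_le_compat_l; lra).
    lra.
  - exact (is_RInt_linear _ _ Pm _ _ _ _ Pm_lin HI). }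
apply Rle_trans with (p * norm (Pm I)).
- apply Hp; [apply Xm_Pm|].
  rewrite (linear_minus i), !i_UV, !i_stable_part, U_add, <- (Pm_U _ k) by (trivial; lra).
  rewrite <- (linear_minus (U s)) by auto.
  rewrite <- (linear_minus Pm) by trivial.
  do 2 f_equal; rewrite Heq; module_eq.
- rewrite !Rmult_assoc; rewrite !Rmult_assoc in HPI.
  now apply Rmult_le_compat_l.
Qed.

Lemma y_RInt_backward eta : 0 < eta -> exists d, 0 < d /\
  forall k t, 0 < k < d -> 0 <= t <= T ->
  RInt (fun r => norm (y r)) (t - k) t <= k * (norm (y t) + eta).
Proof.
intros He.
(* The segment starts at -1 because the integral looks back from [t >= 0] by less than 1. *)
destruct (unifcont_normed_1d y (-1) T (fun s _ => y_cont s) (mkposreal _ He)) as [d Hd].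
exists (Rmin 1 d); split; [apply Rmin_glb_lt; [lra|apply cond_pos]|].
intros k t [Hk0 Hk] Ht; apply Rmin_Rgt_l in Hk; destruct Hk as [Hk1 Hk2].
replace k with (t - (t - k)) at 2 by ring.
apply RInt_le_const; [lra| |].
- apply ex_RInt_continuous_on; [lra|]; intros r _; now apply continuous_norm_comp.
- intros r Hr.
  assert (H : norm (minus (y r) (y t)) < eta).
  { apply (Hd t r); try lra.
    change (Rabs (r - t) < d); apply Rabs_def1; lra. }
  generalize (norm_le_minus (y r) (y t)); lra.
Qed.

Let Y := RInt (fun t => norm (y t)) 0 T.

Lemma Y_ge0 : 0 <= Y.
Proof.
rewrite <- (Rmult_0_r (T - 0)); apply RInt_ge_const; [lra| |].
- apply ex_RInt_continuous_on; [lra|]; intros r _; now apply continuous_norm_comp.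
- intros s _; apply norm_ge_0.
Qed.

(** Integrating the pointwise step over a period, the lag [t - k] disappears by periodicity. The
    threshold [d] depends on neither [p] nor [s], which allows [p] to vary with [s] afterwards. *)
Lemma propagated_L1_step eta : 0 < eta -> exists d, 0 < d /\
  forall p s k, 0 <= s -> 0 < k < d ->
  (forall w v, Xm w -> i v = U s w -> norm v <= p * norm w) -> 0 <= p ->
  propagated_L1 s <= propagated_L1 (s + k) + k * (p * (K * L * (Y + T * eta))).
Proof.
intros He; destruct (y_RInt_backward eta He) as [d [Hd H]].
exists d; split; trivial; intros p s k Hs Hk Hp Hp0.
set (f := fun t => norm (UV (s + k) (stable_part t))).
assert (Hf : forall t, continuous f t) by (apply propagated_continuous; lra).
assert (Hny : forall t, continuous (fun r => norm (y r)) t)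
  by (intros; now apply continuous_norm_comp).
set (C := p * K * L * k).
assert (HC : 0 <= C) by (unfold C; repeat apply Rmult_le_pos; lra).
assert (Hle : propagated_L1 s <=
  RInt (fun t => 1 * f (t + - k) + C * (1 * norm (y t) + eta * 1)) 0 T).
{ apply RInt_le; [lra| | |].
  - apply ex_RInt_continuous_on; [lra|]; intros t _; now apply propagated_continuous.
  - apply ex_RInt_continuous_on; [lra|]; intros t _.
    apply continuous_linear_comb.
    + apply (continuous_comp (fun t => t + - k) f); [|apply Hf].
      apply (continuous_plus (V := R_NormedModule) (fun t => t) (fun _ => - k));
        [apply continuous_id|apply continuous_const].
    + apply continuous_linear_comb; [apply Hny|apply continuous_const].
  - intros t Ht.
    eapply Rle_trans; [apply (stable_part_step p s k t); trivial; lra|].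
    specialize (H k t Hk ltac:(lra)).
    unfold f; replace (t + - k) with (t - k) by ring.
    apply Rle_trans with (norm (UV (s + k) (stable_part (t - k))) +
      p * K * L * (k * (norm (y t) + eta))); [|unfold C; lra].
    apply Rplus_le_compat_l, Rmult_le_compat_l; trivial.
    repeat apply Rmult_le_pos; lra. }
rewrite RInt_linear_comb in Hle.
- rewrite (RInt_periodic f T (- k) Hf) in Hle
    by (intros t; unfold f; now rewrite stable_part_periodic).
  rewrite (RInt_linear_comb (fun t => norm (y t)) (fun _ => 1)) in Hle
    by (trivial; intros; apply continuous_const).
  replace (RInt (fun _ : R => 1) 0 T) with T in Hle.
  2: { symmetry; rewrite (RInt_const (V := R_CompleteNormedModule)).
       change ((T - 0) * 1 = T); ring. }
  change (RInt f 0 T) with (propagated_L1 (s + k)) in Hle.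
  fold Y in Hle; unfold C in Hle; nra.
- intros t; apply (continuous_comp (fun t => t + - k) f); [|apply Hf].
  apply (continuous_plus (V := R_NormedModule) (fun t => t) (fun _ => - k));
    [apply continuous_id|apply continuous_const].
- intros t; apply continuous_linear_comb; [apply Hny|apply continuous_const].
Qed.

Lemma propagated_L1_le (p : R -> R) (a b : R) : 0 <= a <= b ->
  (forall s, a <= s <= b -> continuous p s) ->
  (forall s, a <= s <= b -> 0 <= p s) ->
  (forall s w v, a <= s <= b -> Xm w -> i v = U s w -> norm v <= p s * norm w) ->
  propagated_L1 a <= propagated_L1 b + K * L * Y * RInt p a b.
Proof.
intros Hab Hpc Hp0 Hp.
assert (HKL : 0 <= K * L) by nra.
assert (HY := Y_ge0).
assert (Hoc : forall s, - b <= s <= - a -> continuous (fun r => p (- r)) s).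
{ intros s Hs; apply (continuous_comp (fun r => - r) p); [|apply Hpc; lra].
  apply (continuous_opp (V := R_NormedModule) (fun r => r)), continuous_id. }
assert (H : propagated_L1 (- - a) <= propagated_L1 (- - b) +
  RInt (fun s => K * L * Y * p (- s)) (- b) (- a)).
(* The steps bound [Phi] at [s] by [Phi] at a larger argument, so time is reversed to turn them into
   forward increments. *)
{ apply (increment_le_RInt (fun s => propagated_L1 (- s))); [lra| | |].
  - intros s Hs; apply (continuous_scal_r (V := R_NormedModule)); now apply Hoc.
  - intros s Hs eps Heps.
    destruct (propagated_L1_step 1 Rlt_0_1) as [d [Hd H]].
    assert (Hps := Hp0 (- s) ltac:(lra)).
    set (w := p (- s) * (K * L * (Y + T * 1))).
    assert (Hw : 0 <= w) by (unfold w; repeat apply Rmult_le_pos; lra).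
    exists (Rmin d (eps / (w + 1))); split.
    { apply Rmin_glb_lt; trivial; apply Rdiv_lt_0_compat; lra. }
    intros k [Hk0 Hk] Hks; apply Rmin_Rgt_l in Hk; destruct Hk as [Hk1 Hk2].
    specialize (H (p (- s)) (- s) k ltac:(lra) ltac:(lra)
      (fun w v => Hp (- s) w v ltac:(lra)) Hps).
    replace (- s + k) with (- (s - k)) in H by ring; fold w in H.
    assert (H1 : k * (w + 1) <= eps / (w + 1) * (w + 1))
      by (apply Rmult_le_compat_r; lra).
    replace (eps / (w + 1) * (w + 1)) with eps in H1 by (field; lra); lra.
  - intros s Hs eps Heps.
    assert (Hps := Hp0 (- s) ltac:(lra)).
    (* Expanding [(p + eta) K L (Y + T eta)] with [eta <= 1] leaves an error of at most [eta w]
       beyond the rate [K L Y p]. *)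
    set (w := K * L * (Y + T * p (- s) + T) + 1).
    assert (HTp : 0 <= T * p (- s)) by nra.
    assert (Hw : 0 < w) by (unfold w; nra).
    set (eta := Rmin 1 (eps / w)).
    assert (He1 : eta <= 1) by apply Rmin_l.
    assert (He2 : eta * w <= eps).
    { replace eps with (eps / w * w) by (field; lra).
      apply Rmult_le_compat_r; [lra|apply Rmin_r]. }
    assert (He0 : 0 < eta)
      by (apply Rmin_glb_lt; [lra|now apply Rdiv_lt_0_compat]).
    destruct (propagated_L1_step eta He0) as [d1 [Hd1 H1]].
    destruct (proj1 (continuous_R_iff _ _) (Hpc (- s) ltac:(lra)) eta He0)
      as [d2 [Hd2 H2]].
    exists (Rmin d1 d2); split; [now apply Rmin_glb_lt|].
    intros k [Hk0 Hk] Hks; apply Rmin_Rgt_l in Hk; destruct Hk as [Hk1 Hk2].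
    (* The step begins at the smaller argument [- (s + k)], where [p] is evaluated; continuity of
       [p] compares this value with [p (- s)]. *)
    specialize (H1 (p (- (s + k))) (- (s + k)) k ltac:(lra) ltac:(lra)
      (fun w v => Hp (- (s + k)) w v ltac:(lra)) (Hp0 (- (s + k)) ltac:(lra))).
    replace (- (s + k) + k) with (- s) in H1 by ring.
    specialize (H2 (- (s + k))); apply Rabs_def2 in H2; [|apply Rabs_def1; lra].
    eapply Rle_trans; [exact H1|].
    apply Rplus_le_compat_l, Rmult_le_compat_l; [lra|].
    assert (HTe : 0 <= T * eta) by nra.
    apply Rle_trans with ((p (- s) + eta) * (K * L * (Y + T * eta))).
    + apply Rmult_le_compat_r; [apply Rmult_le_pos; lra|lra].
    + assert (H3 : K * L * (T * (eta * eta)) <= K * L * (T * eta)).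
      { apply Rmult_le_compat_l; trivial; apply Rmult_le_compat_l; nra. }
      unfold w in He2; nra. }
rewrite !Ropp_involutive in H.
replace (RInt (fun s => K * L * Y * p (- s)) (- b) (- a))
  with (K * L * Y * RInt p a b) in H; trivial.
symmetry; apply (is_RInt_unique (V := R_CompleteNormedModule)).
apply (is_RInt_scal (V := R_NormedModule)).
assert (HI : is_RInt p a b (RInt p a b)).
{ apply (RInt_correct (V := R_CompleteNormedModule)), ex_RInt_continuous_on; trivial; lra. }
apply (is_RInt_swap (V := R_NormedModule)) in HI.
rewrite <- (Ropp_involutive a), <- (Ropp_involutive b) in HI at 1.
apply (is_RInt_comp_opp (V := R_NormedModule)) in HI.
apply (is_RInt_opp (V := R_NormedModule)) in HI.
replace (RInt p a b) with (- - RInt p a b) by ring.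
eapply (is_RInt_ext (V := R_NormedModule)); [|exact HI].
intros s _; exact (Ropp_involutive (p (- s))).
Qed.

(** This justifies the limit at the singular end. Strong continuity of [UV] holds at each
    [stable_part t]; contractivity on differences of stable parts spreads it to nearby times, and
    compactness of [[0, T]] makes it uniform. *)
Lemma propagated_L1_at_0 eta : 0 < eta -> exists d, 0 < d /\
  forall s, 0 < s < d -> propagated_L1 0 <= propagated_L1 s + T * eta.
Proof.
intros He.
destruct (uniform_on_segment
  (fun s t => norm (minus (UV s (stable_part t)) (stable_part t)) <= eta) 0 T)
  as [d [Hd H]].
{ intros t Ht.
  destruct (proj1 (continuous_norm_iff _ _) (stable_part_continuous t) (eta / 3))
    as [d1 [Hd1 H1]]; [lra|].
  destruct (proj1 (at_right_norm_iff _ _) (UV_cont (stable_part t)) (eta / 3))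
    as [d2 [Hd2 H2]]; [lra|].
  exists (Rmin d1 d2); split; [now apply Rmin_glb_lt|].
  intros t' s _ Ht' [Hs0 Hs].
  assert (Hm1 := Rmin_l d1 d2); assert (Hm2 := Rmin_r d1 d2).
  specialize (H1 t' ltac:(lra)); specialize (H2 s ltac:(lra)).
  assert (H3 := Xm_V _ s (Xm_i_stable_part_minus t' t) ltac:(lra)).
  assert (H4 : exp (- (mu * s)) <= 1) by (rewrite <- exp_0; apply exp_monotone; nra).
  assert (H5 := norm_ge_0 (minus (stable_part t') (stable_part t))).
  rewrite (linear_minus (UV s)) in H3 by (apply UV_lin; lra).
  assert (H6 := norm_minus_triangle (UV s (stable_part t)) (UV s (stable_part t'))
                  (stable_part t')).
  assert (H7 := norm_minus_triangle (stable_part t) (UV s (stable_part t))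
                  (stable_part t')).
  rewrite (norm_minus_sym (stable_part t)) in H7.
  nra. }
exists d; split; trivial; intros s Hs.
unfold propagated_L1.
replace (RInt (fun t => norm (UV s (stable_part t))) 0 T + T * eta)
  with (RInt (fun t => 1 * norm (UV s (stable_part t)) + eta * 1) 0 T).
- apply RInt_le; [lra| | |].
  + apply ex_RInt_continuous_on; [lra|]; intros t _; apply propagated_continuous; lra.
  + apply ex_RInt_continuous_on; [lra|]; intros t _.
    apply continuous_linear_comb; [apply propagated_continuous; lra|].
    apply continuous_const.
  + intros t Ht; rewrite UV_0; specialize (H s t Hs ltac:(lra)).
    rewrite norm_minus_sym in H.
    generalize (norm_le_minus (stable_part t) (UV s (stable_part t))); lra.
- rewrite (RInt_linear_comb (fun t => norm (UV s (stable_part t))) (fun _ => 1)).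
  + rewrite (RInt_const (V := R_CompleteNormedModule)).
    change (1 * RInt (fun t => norm (UV s (stable_part t))) 0 T + eta * ((T - 0) * 1)
      = RInt (fun t => norm (UV s (stable_part t))) 0 T + T * eta).
    ring.
  + intros t; apply propagated_continuous; lra.
  + intros t; apply continuous_const.
Qed.

Lemma propagated_L1_decay s : 0 <= s ->
  propagated_L1 s <= exp (- (mu * s)) * propagated_L1 0.
Proof.
intros Hs.
assert (Hc : forall t, continuous (fun r => norm (UV 0 (stable_part r))) t)
  by (apply propagated_continuous; lra).
replace (exp (- (mu * s)) * propagated_L1 0) with
  (RInt (fun t => exp (- (mu * s)) * norm (UV 0 (stable_part t))
                  + 0 * norm (UV 0 (stable_part t))) 0 T).
2: { rewrite (RInt_linear_comb (fun t => norm (UV 0 (stable_part t)))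
       (fun t => norm (UV 0 (stable_part t)))) by trivial.
     change (exp (- (mu * s)) * propagated_L1 0 + 0 * propagated_L1 0 =
             exp (- (mu * s)) * propagated_L1 0); ring. }
apply RInt_le; [lra| | |].
- apply ex_RInt_continuous_on; [lra|]; intros t _; now apply propagated_continuous.
- apply ex_RInt_continuous_on; [lra|]; intros t _.
  now apply continuous_linear_comb.
- intros t _; rewrite UV_0, Rmult_0_l, Rplus_0_r.
  apply Xm_V; trivial; apply Xm_i_stable_part.
Qed.

Lemma RInt_exp_le (C a b : R) : 0 <= C -> a <= b ->
  RInt (fun s => C * exp (- (mu * s))) a b <= C * exp (- (mu * a)) / mu.
Proof.
intros HC Hab.
assert (H : is_RInt (fun s => C * exp (- (mu * s))) a b
  (minus (- (C / mu) * exp (- (mu * b))) (- (C / mu) * exp (- (mu * a))))).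
{ apply (is_RInt_derive (V := R_CompleteNormedModule) (fun s => - (C / mu) * exp (- (mu * s)))).
  - intros x _; auto_derive; trivial; field; lra.
  - intros x _; apply (ex_derive_continuous (V := R_NormedModule)).
    auto_derive; trivial. }
rewrite (is_RInt_unique (V := R_CompleteNormedModule) _ _ _ _ H).
change (- (C / mu) * exp (- (mu * b)) + - (- (C / mu) * exp (- (mu * a)))
  <= C * exp (- (mu * a)) / mu).
assert (H1 := exp_pos (- (mu * b))).
assert (H2 : 0 <= C / mu) by (apply Rdiv_le_0_compat; lra).
assert (H3 : 0 <= C / mu * exp (- (mu * b))) by nra.
unfold Rdiv in *; lra.
Qed.

(** The improper integral enters only through upper bounds on its truncations. The estimate of [Phi]
    is split at [T]: the tail is handled on [[T, N]] with [N] large, the rest on [[s, T]] with [s]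
    tending to 0. *)
Lemma stable_part_L1 (J : R) :
  (forall eta, 0 < eta -> exists d, 0 < d /\ forall s, 0 < s < d ->
     RInt (fun r => m r * exp (- (mu * r))) s T <= J + eta) ->
  RInt (fun t => norm (stable_part t)) 0 T <=
  K * L * Y * (J + m T * exp (- (mu * T)) / mu).
Proof.
intros HJ.
assert (H0 : propagated_L1 0 = RInt (fun t => norm (stable_part t)) 0 T).
{ apply (RInt_ext (V := R_CompleteNormedModule)); intros t _; now rewrite UV_0. }
rewrite <- H0.
assert (HKLY : 0 <= K * L * Y) by (assert (HY := Y_ge0); repeat apply Rmult_le_pos; lra).
set (B := m T * exp (- (mu * T)) / mu).
assert (HmT := m_pos T T_gt0).
assert (Hexpc : forall s, continuous (fun r => exp (- (mu * r))) s).
{ intros s; apply (ex_derive_continuous (V := R_NormedModule)); auto_derive; trivial. }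
assert (HP0 : 0 <= propagated_L1 0).
{ rewrite <- (Rmult_0_r (T - 0)); apply RInt_ge_const; [lra| |].
  - apply ex_RInt_continuous_on; [lra|]; intros t _; apply propagated_continuous; lra.
  - intros s _; apply norm_ge_0. }
assert (Htail : propagated_L1 T <= K * L * Y * B).
{ apply le_epsilon; intros eps Heps.
  (* With this [N], [mu N eps >= Phi(0)], so [1 + mu N <= exp (mu N)] gives
     [exp (- mu N) Phi(0) <= eps]. *)
  set (N := T + propagated_L1 0 / (mu * eps)).
  assert (HN : T <= N).
  { assert (0 <= propagated_L1 0 / (mu * eps)) by (apply Rdiv_le_0_compat; nra).
    unfold N; lra. }
  assert (H1 := propagated_L1_le (fun s => m T * exp (- (mu * s))) T N ltac:(lra)).
  assert (H2 := propagated_L1_decay N ltac:(lra)).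
  assert (H3 : exp (- (mu * N)) * propagated_L1 0 <= eps).
  { assert (H4 := exp_ineq1_le (mu * N)).
    rewrite exp_Ropp; assert (Hp := exp_pos (mu * N)).
    apply Rmult_le_reg_l with (exp (mu * N)); trivial.
    rewrite <- Rmult_assoc, Rinv_r, Rmult_1_l by lra.
    assert (H5 : mu * N * eps = mu * T * eps + propagated_L1 0)
      by (unfold N; field; lra).
    assert (0 < mu * T * eps) by (repeat apply Rmult_lt_0_compat; lra).
    nra. }
  assert (H4 := RInt_exp_le (m T) T N ltac:(lra) HN); fold B in H4.
  assert (H5 : K * L * Y * RInt (fun s => m T * exp (- (mu * s))) T N <= K * L * Y * B)
    by (apply Rmult_le_compat_l; lra).
  enough (propagated_L1 T <= propagated_L1 N +
    K * L * Y * RInt (fun s => m T * exp (- (mu * s))) T N) by lra.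
  apply H1.
  - intros s _; apply (continuous_scal_r (V := R_NormedModule)); apply Hexpc.
  - intros s _; assert (Hp := exp_pos (- (mu * s))); nra.
  - intros s w v Hs Hw Hv.
    destruct (Rle_lt_or_eq_dec T s (proj1 Hs)) as [HTs|<-]; [|now apply Xm_XV].
    (* Beyond [T] smoothing is used at time [T] alone, followed by the decay of the semigroup in [V]
       during [s - T]; the exponentials combine to [exp (- mu s)]. *)
    destruct (V_smoothing w T Hw T_gt0) as [v' Hv'].
    assert (Hvv : v = UV (s - T) v').
    { apply i_inj; rewrite i_UV, Hv, Hv', <- U_add by lra; f_equal; ring. }
    assert (H6 := Xm_V v' (s - T)); rewrite Hv' in H6.
    specialize (H6 (U_Xm w T Hw ltac:(lra)) ltac:(lra)).
    assert (H7 := Xm_XV w v' T Hw T_gt0 Hv').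
    rewrite Hvv.
    replace (exp (- (mu * s))) with (exp (- (mu * (s - T))) * exp (- (mu * T)))
      by (rewrite <- exp_plus; f_equal; ring).
    assert (Hp := exp_pos (- (mu * (s - T)))).
    apply Rle_trans with (exp (- (mu * (s - T))) * (m T * exp (- (mu * T)) * norm w));
      [|lra].
    eapply Rle_trans; [exact H6|]; apply Rmult_le_compat_l; lra. }
assert (Hall : forall eta, 0 < eta ->
  propagated_L1 0 <= K * L * Y * (J + B) + (T + K * L * Y) * eta).
{ intros eta He.
  destruct (HJ eta He) as [d1 [Hd1 H1]].
  destruct (propagated_L1_at_0 eta He) as [d2 [Hd2 H2]].
  set (s := Rmin T (Rmin d1 d2) / 2).
  assert (Hm0 : 0 < Rmin T (Rmin d1 d2)) by (repeat apply Rmin_glb_lt; trivial).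
  assert (Hm1 := Rmin_l T (Rmin d1 d2)); assert (Hm2 := Rmin_r T (Rmin d1 d2)).
  assert (Hm3 := Rmin_l d1 d2); assert (Hm4 := Rmin_r d1 d2).
  specialize (H1 s ltac:(unfold s; lra)); specialize (H2 s ltac:(unfold s; lra)).
  assert (Hs : 0 < s <= T) by (unfold s; lra).
  assert (H3 : propagated_L1 s <= propagated_L1 T +
    K * L * Y * RInt (fun r => m r * exp (- (mu * r))) s T).
  { apply propagated_L1_le; [lra| | |].
    - intros r Hr; apply (continuous_mult (K := R_AbsRing)); [apply m_cont; lra|apply Hexpc].
    - intros r Hr; assert (Hp := exp_pos (- (mu * r))).
      assert (Hmr := m_pos r ltac:(lra)); nra.
    - intros r w v Hr Hw Hv; apply Xm_XV; trivial; lra. }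
  assert (H4 : K * L * Y * RInt (fun r => m r * exp (- (mu * r))) s T <=
               K * L * Y * (J + eta)) by (apply Rmult_le_compat_l; lra).
  lra. }
apply le_epsilon; intros eps Heps.
assert (Hden : 0 < T + K * L * Y) by lra.
specialize (Hall (eps / (T + K * L * Y)) ltac:(now apply Rdiv_lt_0_compat)).
replace ((T + K * L * Y) * (eps / (T + K * L * Y))) with eps in Hall by (field; lra).
exact Hall.
Qed.

End StablePart.

(** * The operator norms and the improper integral of the statement *)

(** The supremum must first be shown finite, as [real] would replace an infinite one by 0: the zero
    vector bounds it below, boundedness of [f] above. Normalising [x] then gives the inequality. *)
Lemma sup_unit_ball_bound (E G : NormedModule R_AbsRing) (f : E -> G) (N : R) :
  is_linear f ->
  N = real (Lub_Rbar (fun r => exists x : E, norm x <= 1 /\ r = norm (f x))) ->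
  0 <= N /\ forall x, norm (f x) <= N * norm x.
Proof.
intros Hf ->; destruct (linear_norm f Hf) as [C [HC HCf]].
destruct (Lub_Rbar_correct (fun r => exists x : E, norm x <= 1 /\ r = norm (f x)))
  as [Hub Hlub].
set (l := Lub_Rbar (fun r => exists x : E, norm x <= 1 /\ r = norm (f x))) in *.
assert (H0 : Rbar_le 0 l).
{ apply Hub; exists (zero : E); split.
  - eapply Rle_trans; [right; exact (norm_zero (V := E))|lra].
  - symmetry; etransitivity; [|exact (norm_zero (V := G))].
    f_equal; exact (linear_zero f Hf). }
assert (HlC : Rbar_le l C).
{ apply Hlub; intros r [x [Hx ->]]; simpl; specialize (HCf x); nra. }
destruct l as [l| |]; try contradiction; simpl in *.
split; trivial; intros x.
destruct (norm_ge_0 x) as [Hx|Hx]; [|specialize (HCf x); rewrite <- Hx in *; lra].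
assert (Hix := Rinv_0_lt_compat _ Hx).
assert (H := Hub (norm (f (scal (/ norm x) x)))); simpl in H.
rewrite (linear_scal_R f Hf), norm_scal_pos in H by lra.
assert (H1 : / norm x * norm (f x) <= l).
{ apply H; exists (scal (/ norm x) x); split.
  - rewrite norm_scal_pos, Rinv_l by lra; lra.
  - rewrite (linear_scal_R f Hf), norm_scal_pos by lra; reflexivity. }
apply (Rmult_le_compat_r (norm x)) in H1; [|lra].
rewrite (Rmult_comm (/ norm x)), Rmult_assoc, Rinv_l in H1; lra.
Qed.

Lemma op_norm_bound (E G : CompleteNormedModule R_AbsRing) (f : E -> G) :
  is_linear f -> 0 <= op_norm f /\ forall x, norm (f x) <= op_norm f * norm x.
Proof.
intros Hf.
exact (sup_unit_ball_bound (CompleteNormedModule.NormedModule _ E)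
         (CompleteNormedModule.NormedModule _ G) f (op_norm f) Hf eq_refl).
Qed.

Lemma is_RInt_gen_at_right_iff (f : R -> R) (T J : R) :
  is_RInt_gen f (at_right 0) (at_point T) J <->
  forall eta, 0 < eta -> exists d, 0 < d /\
    forall s, 0 < s < d -> exists I, is_RInt f s T I /\ Rabs (I - J) < eta.
Proof.
split.
- intros H eta He.
  destruct (H (fun I => Rabs (I - J) < eta)) as [Q S [d Hd] HS HQS].
  { exists (mkposreal _ He); intros I HI; exact HI. }
  exists d; split; [apply cond_pos|]; intros s Hs.
  apply (HQS s T); [|exact HS].
  apply Hd; [|lra]; change (Rabs (s - 0) < d); rewrite Rabs_pos_eq; lra.
- intros H P [eta Heta].
  destruct (H eta (cond_pos eta)) as [d [Hd Hs]].
  apply Filter_prod with (fun s => 0 < s < d) (fun t => t = T).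
  + exists (mkposreal _ Hd); intros s Hs1 Hs2; split; [exact Hs2|].
    change (Rabs (s - 0) < d) in Hs1; rewrite Rabs_pos_eq in Hs1; lra.
  + reflexivity.
  + intros s t Hs0 ->; destruct (Hs s Hs0) as [I [HI1 HI2]].
    exists I; split; [exact HI1|]; apply Heta; exact HI2.
Qed.

(** The substitution [s = mu r]. Convergence is transferred together with the value, so that
    [RInt_gen] denotes the actual improper integral. *)
Lemma RInt_gen_rescale (m : R -> R) (mu T J : R) : 0 < mu ->
  is_RInt_gen (fun s => m s * exp (- (mu * s))) (at_right 0) (at_point T) J ->
  RInt_gen (fun s => m (s / mu) * exp (- s)) (at_right 0) (at_point (mu * T)) = mu * J.
Proof.
intros Hmu HJ; apply (is_RInt_gen_unique (V := R_CompleteNormedModule)).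
apply is_RInt_gen_at_right_iff; intros eta He.
destruct (proj1 (is_RInt_gen_at_right_iff _ _ _) HJ (eta / mu)) as [d [Hd H]].
{ now apply Rdiv_lt_0_compat. }
exists (mu * d); split; [nra|]; intros s Hs.
assert (Hs' : s = mu * (/ mu * s)) by (field; lra).
destruct (H (/ mu * s)) as [I [HI1 HI2]].
{ assert (Hi := Rinv_0_lt_compat mu Hmu); split; [nra|].
  apply Rmult_lt_reg_l with mu; lra. }
exists (mu * I); split.
- apply (is_RInt_ext (V := R_NormedModule)) with
    (fun r => scal mu (scal (/ mu)
       (m (/ mu * r + 0) * exp (- (mu * (/ mu * r + 0)))))).
  + intros r _.
    change (mu * (/ mu * (m (/ mu * r + 0) * exp (- (mu * (/ mu * r + 0))))) =
            m (r / mu) * exp (- r)).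
    replace (/ mu * r + 0) with (r / mu) by (field; lra).
    replace (mu * (r / mu)) with r by (field; lra); field; lra.
  + apply (is_RInt_scal (V := R_NormedModule)).
    apply (is_RInt_comp_lin (V := R_NormedModule)
             (fun s => m s * exp (- (mu * s))) (/ mu) 0).
    replace (/ mu * (mu * T) + 0) with T by (field; lra).
    rewrite Rplus_0_r; exact HI1.
- replace (mu * I - mu * J) with (mu * (I - J)) by ring.
  rewrite Rabs_mult, (Rabs_pos_eq mu) by lra.
  apply Rmult_lt_compat_l with (r := mu) in HI2; trivial.
  replace (mu * (eta / mu)) with eta in HI2 by (field; lra); exact HI2.
Qed.

(** * Differences of translates and the final estimate *)

Lemma periodic_L1_pos {V : NormedModule R_AbsRing} (y : R -> V) (T t0 : R) :
  0 < T -> (forall t, continuous y t) -> (forall t, y (t + T) = y t) ->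
  y t0 <> zero -> 0 < RInt (fun t => norm (y t)) 0 T.
Proof.
intros HT Hy Hper H0.
set (f := fun t => norm (y t)).
assert (Hf : forall t, continuous f t) by (intros; now apply continuous_norm_comp).
rewrite <- (RInt_periodic f T t0 Hf) by (intros t; unfold f; now rewrite Hper).
set (f' := fun t => f (t + t0)).
assert (Hf' : forall t, continuous f' t).
{ intros t; apply (continuous_comp (fun t => t + t0) f); [|apply Hf].
  apply (continuous_plus (V := R_NormedModule) (fun t => t) (fun _ => t0));
    [apply continuous_id|apply continuous_const]. }
assert (Hp : 0 < f t0).
{ destruct (norm_ge_0 (y t0)) as [H|H]; [exact H|].
  exfalso; apply H0, norm_eq_zero; now symmetry. }
destruct (proj1 (continuous_R_iff _ _) (Hf' 0) (f t0 / 2) ltac:(lra)) as [d [Hd H]].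
set (k := Rmin (d / 2) T).
assert (Hk0 : 0 < k) by (apply Rmin_glb_lt; lra).
assert (Hk1 : k <= d / 2) by apply Rmin_l.
assert (Hk2 : k <= T) by apply Rmin_r.
rewrite <- (RInt_Chasles_on f' 0 k T) by (auto; lra).
assert (H1 : (k - 0) * (f t0 / 2) <= RInt f' 0 k).
{ apply RInt_ge_const; [lra| |].
  - apply ex_RInt_continuous_on; [lra|]; auto.
  - intros s Hs; specialize (H s); apply Rabs_def2 in H; [|apply Rabs_def1; lra].
    unfold f' in H at 2 4; rewrite Rplus_0_l in H; lra. }
assert (H2 : (T - k) * 0 <= RInt f' k T).
{ apply RInt_ge_const; [lra| |].
  - apply ex_RInt_continuous_on; [lra|]; auto.
  - intros s _; apply norm_ge_0. }
nra.
Qed.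

Lemma complete_integrable (V : CompleteNormedModule R_AbsRing) (f : R -> V) :
  (forall t, continuous f t) -> forall a b, exists I, is_RInt f a b I.
Proof.
intros Hf a b; apply (ex_RInt_continuous (V := V)); intros t _; apply Hf.
Qed.

(** The equation is autonomous, so [z(. + h)] is again a mild solution; subtraction leaves the
    linear formula with a difference of values of [f] as forcing. *)
Lemma difference_mild (X V : NormedModule R_AbsRing) (U : R -> X -> X) (i : V -> X)
    (f : R -> X) (z : R -> V) (h : R) :
  is_linear i -> (forall t, 0 <= t -> is_linear (U t)) ->
  (forall t0 t, t0 < t -> exists I,
     is_RInt (fun s => U (t - s) (f s)) t0 t I /\
     i (z t) = plus (U (t - t0) (i (z t0))) I) ->
  forall t0 t, t0 < t -> exists I,
     is_RInt (fun s => U (t - s) (minus (f (s + h)) (f s))) t0 t I /\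
     i (minus (z (t + h)) (z t)) =
       plus (U (t - t0) (i (minus (z (t0 + h)) (z t0)))) I.
Proof.
intros Hi HU Hz t0 t Ht.
destruct (Hz t0 t Ht) as [I [HI Heq]].
destruct (Hz (t0 + h) (t + h) ltac:(lra)) as [I' [HI' Heq']].
exists (minus I' I); split.
- apply is_RInt_shift in HI'.
  assert (H := is_RInt_minus _ _ _ _ _ _ HI' HI).
  apply is_RInt_ext with (2 := H).
  rewrite Rmin_left, Rmax_right by lra; intros s Hs.
  replace (t + h - (s + h)) with (t - s) by ring.
  rewrite (linear_minus (U (t - s))) by (apply HU; lra); reflexivity.
- replace (t + h - (t0 + h)) with (t - t0) in Heq' by ring.
  rewrite !(linear_minus i), (linear_minus (U (t - t0))) by (trivial; apply HU; lra).
  rewrite Heq, Heq'; module_eq.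
Qed.

Theorem theorem1 (X V : CompleteNormedModule R_AbsRing)
  (U : R -> X -> X) (D : X -> Prop) (A : X -> X) (i : V -> X)
  (mu0 M : R) (m : R -> R) (Xm Xp : R -> X -> Prop)
  (Pm : R -> X -> X) (Pp : R -> X -> V)
  (F : V -> X) (L T : R) (z : R -> V)
  (hU : C0_semigroup U) (hA : is_generator U D A)
  (hV : admissible_space U D i)
  (hUHBD : UHBD U D A i mu0 M m Xm Xp)
  (hP : forall mu, mu0 < mu ->
     projections (Xm mu) (Xp mu) (Pm mu) (fun x => i (Pp mu x)))
  (hL : 0 < L)
  (hF : forall z1 z2, norm (minus (F z1) (F z2)) <= L * norm (minus z1 z2))
  (hT : 0 < T)
  (hz : mild_solution U i F m_infty p_infty z)
  (hper : forall t, z (t + T) = z t)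
  (hnonconst : exists t1 t2, z t1 <> z t2) :
  Rbar_le (inv_infty (mu0 * M)) T \/
  (forall mu, mu0 < mu -> mu < 1 / (M * T) ->
     1 <= T * L *
       (op_norm (Pp mu) / (1 - mu * M * T)
        + op_norm (Pm mu) / (mu * T) *
          (exp (- (mu * T)) * m T
           + RInt_gen (fun s => m (s / mu) * exp (- s))
               (at_right 0) (at_point (mu * T))))).
Proof.
(* The second alternative holds in every case: for [T >= 1 / (mu0 M)] no [mu] lies in the
   interval. *)
right; intros mu Hmu0 HmuT.
destruct hU as [U_lin U_0 U_add U_cont].
destruct hV as [i_inj D_V i_lin smooth [UV [[UV_lin UV_0 UV_add UV_cont] i_UV]]].
destruct hUHBD as [Hmu00 HM m_pos m_cont Hdec].
destruct (Hdec mu Hmu0) as [Cm Cp [_ Xmp] p_domain p_stable p_bound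
  m_stable m_XX m_XV m_VV m_int].
specialize (hP mu Hmu0); unfold projections in hP.
set (XN := CompleteNormedModule.NormedModule R_AbsRing X).
set (VN := CompleteNormedModule.NormedModule R_AbsRing V).
assert (Hmu : 0 < mu) by lra.
assert (Hc : 0 <= mu * M) by nra.
assert (HX : seq_complete XN) by apply complete_seq_complete.
assert (HV : seq_complete VN) by apply complete_seq_complete.
assert (X_int := complete_integrable X).
assert (V_int := complete_integrable V).
assert (A_deriv : forall w, Xp mu w -> right_deriv (X := XN) U w (A w)).
{ intros w Hw; apply right_deriv_iff.
  exact (proj1 (hA w (A w)) (conj (p_domain w Hw) eq_refl)). }
assert (Xm_deriv : forall w w', Xm mu w -> right_deriv (X := XN) U w w' -> Xm mu w').
{ intros w w' Hw Hd.
  destruct (proj2 (hA w w') (proj2 (right_deriv_iff (X := XN) U w w') Hd)) as [H1 <-].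
  now apply m_stable. }
assert (Xm_contr : forall w t, Xm mu w -> 0 <= t -> norm (U t w) <= norm w).
{ intros w t Hw [Ht|<-]; [|rewrite U_0; apply Rle_refl].
  eapply Rle_trans; [now apply m_XX|].
  assert (H1 : exp (- (mu * t)) <= 1) by (rewrite <- exp_0; apply exp_monotone; nra).
  assert (H2 := norm_ge_0 w); nra. }
assert (Pp_lin : is_linear (U := XN) (V := VN) (Pp mu)).
{ exact (Pp_linear (X := XN) (V := VN) i (Xm mu) (Xp mu) (Pm mu) (Pp mu) HX HV
    i_lin i_inj (sub_plus Cm) (sub_scal Cm) (sub_closed Cm)
    (sub_plus Cp) (sub_scal Cp) (sub_closed Cp) Xmp hP). }
assert (Pm_lin : is_linear (U := XN) (V := XN) (Pm mu)).
{ exact (Pm_linear (X := XN) (V := VN) i (Xm mu) (Xp mu) (Pm mu) (Pp mu) HX HV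
    i_lin i_inj (sub_plus Cm) (sub_scal Cm) (sub_closed Cm)
    (sub_plus Cp) (sub_scal Cp) (sub_closed Cp) Xmp hP). }
assert (Pp_growth := Pp_semigroup (X := XN) (V := VN) U i A (Xm mu) (Xp mu)
    (Pm mu) (Pp mu) (mu * M) HX HV U_lin U_0 U_add U_cont X_int
    i_lin i_inj (sub_plus Cm) (sub_scal Cm) (sub_closed Cm)
    (sub_plus Cp) (sub_scal Cp) (sub_closed Cp) Xmp hP
    Hc A_deriv p_bound p_stable Xm_deriv).
assert (U_Xm := semigroup_Xm (X := XN) (V := VN) U i A (Xm mu) (Xp mu)
    (Pm mu) (Pp mu) (mu * M) HX HV U_lin U_0 U_add U_cont X_int
    i_lin i_inj (sub_plus Cm) (sub_scal Cm) (sub_closed Cm)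
    (sub_plus Cp) (sub_scal Cp) (sub_closed Cp) Xmp hP
    Hc A_deriv p_bound p_stable Xm_deriv).
assert (Pm_U := Pm_semigroup (X := XN) (V := VN) U i A (Xm mu) (Xp mu)
    (Pm mu) (Pp mu) (mu * M) HX HV U_lin U_0 U_add U_cont X_int
    i_lin i_inj (sub_plus Cm) (sub_scal Cm) (sub_closed Cm)
    (sub_plus Cp) (sub_scal Cp) (sub_closed Cp) Xmp hP
    Hc A_deriv p_bound p_stable Xm_deriv Xm_contr).
assert (Pm_sub := Pm_eq (X := XN) (V := VN) i (Xm mu) (Xp mu) (Pm mu) (Pp mu) hP).
assert (Xm_V : forall v t, Xm mu (i v) -> 0 <= t ->
  norm (UV t v) <= exp (- (mu * t)) * norm v).
{ intros v t Hv [Ht|<-].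
  - destruct (m_VV v t Hv Ht) as [v' [H1 H2]].
    replace (UV t v) with v'; [exact H2|].
    apply i_inj; rewrite H1, i_UV by lra; reflexivity.
  - rewrite UV_0, Rmult_0_r, Ropp_0, exp_0, Rmult_1_l; apply Rle_refl. }
assert (Xm_XV : forall w v t, Xm mu w -> 0 < t -> i v = U t w ->
  norm v <= m t * exp (- (mu * t)) * norm w).
{ intros w v t Hw Ht Hv; destruct (m_XV w t Hw Ht) as [v' [H1 H2]].
  replace v with v'; [exact H2|]; apply i_inj; now rewrite H1, Hv. }
destruct hz as [z_cont0 z_mild0].
assert (z_cont : forall t, continuous z t) by (intros t; now apply z_cont0).
assert (z_mild : forall t0 t, t0 < t -> exists I,
  is_RInt (fun s => U (t - s) (F (z s))) t0 t I /\
  i (z t) = plus (U (t - t0) (i (z t0))) I)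
  by (intros t0 t Ht; now apply z_mild0).
destruct hnonconst as [t1 [t2 Ht12]].
(* This shift makes [y t2 = z t1 - z t2], which is nonzero. *)
set (h := t1 - t2).
set (y := fun t => minus (z (t + h) : VN) (z t)).
set (g := fun t => minus (F (z (t + h)) : XN) (F (z t))).
assert (Hshift : forall t, continuous (fun s => z (s + h)) t).
{ intros t; apply (continuous_comp (fun s => s + h) z); [|apply z_cont].
  apply (continuous_plus (V := R_NormedModule) (fun s => s) (fun _ => h));
    [apply continuous_id|apply continuous_const]. }
assert (y_cont : forall t, continuous (U := VN) y t).
{ intros t; exact (continuous_minus_comp (V := VN) (fun s => z (s + h)) z t
    (Hshift t) (z_cont t)). }
assert (y_per : forall t, y (t + T) = y t).
{ intros t; unfold y; rewrite hper; f_equal.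
  rewrite <- (hper (t + h)); f_equal; ring. }
assert (y_nz : y t2 <> zero).
{ intros H; apply Ht12; unfold y, h in H.
  replace (t2 + (t1 - t2)) with t1 in H by ring.
  assert (Heq : plus (minus (z t1 : VN) (z t2)) (z t2) = z t1) by module_eq.
  rewrite H in Heq; rewrite <- Heq; exact (plus_zero_l (G := VN) _). }
assert (g_le : forall t, norm (V := XN) (g t) <= L * norm (V := VN) (y t))
  by (intros t; apply hF).
assert (y_mild := difference_mild XN VN U i (fun s => F (z s)) z h i_lin U_lin z_mild).
(* By periodicity [z] and its translate have the same integral over [[0, T]]. *)
assert (y_mean : is_RInt (V := VN) y 0 T zero).
{ destruct (V_int z z_cont 0 T) as [I HI].
  assert (HI' := is_RInt_periodic (V := VN) z T h I (V_int z z_cont) hper HI).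
  replace (zero : VN) with (minus (I : VN) I) by (apply (minus_eq_zero (G := VN))).
  exact (is_RInt_minus (V := VN) _ _ _ _ _ _ HI' HI). }
assert (Y_pos := periodic_L1_pos (V := VN) y T t2 hT y_cont y_per y_nz).
destruct (op_norm_bound X V (Pp mu) Pp_lin) as [Kp_ge0 Pp_norm].
destruct (op_norm_bound X X (Pm mu) Pm_lin) as [Km_ge0 Pm_norm].
set (Kp := op_norm (Pp mu)) in *.
set (Km := op_norm (Pm mu)) in *.
assert (HcT : mu * M * T < 1).
{ apply (Rmult_lt_compat_r (M * T)) in HmuT; [|nra].
  replace (1 / (M * T) * (M * T)) with 1 in HmuT by (field; split; lra); lra. }
assert (Hp := unstable_part_L1 (X := XN) (V := VN) U i (Pp mu) y g (mu * M) Kp L T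
  i_lin Pp_lin Hc Kp_ge0 (Rlt_le _ _ hL) hT Pp_norm Pp_growth y_cont g_le y_mild y_mean).
destruct (m_int T hT) as [J HJ].
rewrite (RInt_gen_rescale m mu T J Hmu HJ).
assert (HJ' : forall eta, 0 < eta -> exists d, 0 < d /\ forall s, 0 < s < d ->
  RInt (fun r => m r * exp (- (mu * r))) s T <= J + eta).
{ intros eta He.
  destruct (proj1 (is_RInt_gen_at_right_iff _ _ _) HJ eta He) as [d [Hd H]].
  exists d; split; trivial; intros s Hs; destruct (H s Hs) as [I [HI1 HI2]].
  rewrite (is_RInt_unique (V := R_CompleteNormedModule) _ _ _ _ HI1).
  apply Rabs_def2 in HI2; lra. }
assert (Hm := stable_part_L1 (X := XN) (V := VN) U UV i (Xm mu) (Pm mu) (Pp mu)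
  y g m mu Km L T i_lin i_inj U_lin U_add UV_lin UV_0 UV_cont i_UV Pp_lin Pm_lin
  Pm_sub (fun x => proj1 (hP x)) Pm_U Hmu Km_ge0 (Rlt_le _ _ hL) hT Pm_norm
  Xm_contr Xm_V Xm_XV (fun w t _ Ht => smooth t w Ht) (fun w t Hw Ht => U_Xm w t Ht Hw)
  m_pos m_cont y_cont y_per g_le y_mild J HJ').
cbv zeta in Hm.
set (Y := RInt (fun t => norm (V := VN) (y t)) 0 T) in *.
set (Yp := RInt (fun t => norm (unstable_part (X := XN) (V := VN) i (Pp mu) y t)) 0 T) in *.
set (Ym := RInt (fun t => norm (stable_part (X := XN) (V := VN) i (Pp mu) y t)) 0 T) in *.
assert (HY : Y <= 1 * Yp + 1 * Ym).
{ assert (Hcp := unstable_part_continuous (X := XN) (V := VN) i (Pp mu) y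
    i_lin Pp_lin y_cont).
  assert (Hcm := stable_part_continuous (X := XN) (V := VN) i (Pp mu) y
    i_lin Pp_lin y_cont).
  unfold Yp, Ym; rewrite <- RInt_linear_comb.
  - apply RInt_le; [lra| | |].
    + apply ex_RInt_continuous_on; [lra|]; intros t _.
      now apply (continuous_norm_comp (V := VN)).
    + apply ex_RInt_continuous_on; [lra|]; intros t _.
      apply continuous_linear_comb; apply (continuous_norm_comp (V := VN)); trivial.
    + intros t _; rewrite !Rmult_1_l.
      exact (norm_le_minus (V := VN) (y t) (Pp mu (i (y t)))).
  - intros t; apply (continuous_norm_comp (V := VN)), Hcp.
  - intros t; apply (continuous_norm_comp (V := VN)), Hcm. }
clearbody Y Yp Ym; clear - HY Hp Hm Y_pos HcT Hmu hT.
set (B := J + m T * exp (- (mu * T)) / mu) in *.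
assert (HYp : Yp <= T * L * (Kp / (1 - mu * M * T)) * Y).
{ apply Rmult_le_reg_l with (1 - mu * M * T); [lra|].
  replace ((1 - mu * M * T) * (T * L * (Kp / (1 - mu * M * T)) * Y))
    with (T * (Kp * L * Y)) by (field; lra).
  exact Hp. }
(* [B] is the integral of [p]: [J] over [(0, T]] plus the tail [m(T) exp (- mu T) / mu]. Multiplied
   by [mu], it is the bracket of the statement. *)
replace (Km / (mu * T) * (exp (- (mu * T)) * m T + mu * J)) with (Km / T * B)
  by (unfold B; field; lra).
assert (HYm : Ym <= T * L * (Km / T * B) * Y).
{ replace (T * L * (Km / T * B) * Y) with (Km * L * Y * B) by (field; lra).
  exact Hm. }
apply Rmult_le_reg_r with Y; trivial; lra.
Qed.
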